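(* Let $f$ be an even continuous non-negative function on $\mathbb{R}^n$ and let $\mu$ be the measure on $\mathbb{R}^n$ with density $f$. Let $K$ and $L$ be origin-symmetric star bodies in $\mathbb{R}^n$, and let $1<k<n$ be an integer. Suppose that $K$ is a generalized $k$-intersection body and $\varepsilon>0$. If for every $(n-k)$-dimensional linear subspace $H$ of $\mathbb{R}^n$ $$\mu(K\cap H)\le \mu(L\cap H)+\varepsilon,$$ then $$\mu(K)\le \mu(L)+\frac{n}{n-k}\,c_{n,k}\,\mathrm{Vol}_n(K)^{k/n}\,\varepsilon,$$ where $c_{n,k}=|B_2^n|^{(n-k)/n}/|B_2^{n-k}|$.
   Context: $|B_2^m|$ denotes the volume of the Euclidean unit ball in $\mathbb{R}^m$, and $\mathrm{Vol}_n$ is $n$-dimensional Lebesgue measure. $S^{n-1}$ is the Euclidean unit sphere in $\mathbb{R}^n$. For a closed bounded set $B\subset\mathbb{R}^n$, $\mu(B)=\int_B f(x)\,dx$; for an $(n-k)$-dimensional subspace $H$, $\mu(B\cap H)=\int_{B\cap H}f(x)\,dx$, where the integral is with respect to $(n-k)$-dimensional Lebesgue measure on $H$. A closed bounded set $K\subset\mathbb{R}^n$ is a star body if every straight line through the origin crosses the boundary of $K$ at exactly two points different from the origin, the origin is an interior point of $K$, and the Minkowski functional $\|x\|_K=\min\{a\ge 0: x\in aK\}$ is a continuous function on $\mathbb{R}^n$. It is origin-symmetric if $K=-K$. $G(n,n-k)$ is the Grassmannian of $(n-k)$-dimensional linear subspaces of $\mathbb{R}^n$. The $(n-k)$-dimensional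 spherical Radon transform $\mathcal{R}_{n-k}:C(S^{n-1})\to C(G(n,n-k))$ is defined by $\mathcal{R}_{n-k}(g)(H)=\int_{S^{n-1}\cap H} g(x)\,dx$, where integration is with respect to the (unnormalized) surface measure on the unit sphere $S^{n-1}\cap H$ of $H$ (counting measure if $n-k=1$). Let $X=\mathcal{R}_{n-k}(C(S^{n-1}))\subset C(G(n,n-k))$, and let $M^+(X)$ be the set of linear continuous (in the sup norm) functionals $\nu$ on $X$ that are positive, i.e. $\nu(h)\ge 0$ for every non-negative $h\in X$. An origin-symmetric star body $K$ in $\mathbb{R}^n$ is a generalized $k$-intersection body if there exists $\nu\in M^+(X)$ such that for every $g\in C(S^{n-1})$, $$\int_{S^{n-1}}\|x\|_K^{-k}g(x)\,dx=\nu(\mathcal{R}_{n-k}(g)),$$ where $dx$ is the unnormalized surface measure on $S^{n-1}$. *)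

(* Defs.v *)
From HB Require Import structures.
From mathcomp Require Import all_boot all_order all_algebra.
From mathcomp Require Import all_classical all_reals all_analysis.
From mathcomp Require Import measurable_realfun.

Set Implicit Arguments.
Unset Strict Implicit.
Unset Printing Implicit Defensive.

Import Order.TTheory GRing.Theory Num.Theory.
Import numFieldNormedType.Exports.

Local Open Scope classical_set_scope.
Local Open Scope ring_scope.

(* Row vectors carry the product sigma-algebra, generated by the coordinates;
   over the reals this is the Borel sigma-algebra. *)
Definition rV_display : measure_display -> measure_display.
Proof. exact. Qed.

Section rV_measurable.
Context d (T : measurableType d) (n : nat).

Let coord : 'I_n -> 'rV[T]_n -> T := fun i x => x ord0 i.

Let rV_set0 : g_sigma_preimage coord set0.
Proof. exact: sigma_algebra0. Qed.

Let rV_setC A : g_sigma_preimage coord A -> g_sigma_preimage coord (~` A).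
Proof. exact: sigma_algebraC. Qed.

Let rV_bigcup (F : _^nat) : (forall i, g_sigma_preimage coord (F i)) ->
  g_sigma_preimage coord (\bigcup_i (F i)).
Proof. exact: sigma_algebra_bigcup. Qed.

HB.instance Definition _ := @isMeasurable.Build (rV_display d)
  'rV[T]_n (g_sigma_preimage coord) rV_set0 rV_setC rV_bigcup.

Lemma measurable_coord (i : 'I_n) :
  measurable_fun [set: 'rV[T]_n] (fun x : 'rV[T]_n => x ord0 i : T).
Proof.
move=> _ Y mY; rewrite setTI; apply: sub_sigma_algebra => /=.
rewrite -bigcup_seq/=; exists i => /=; first by rewrite mem_index_enum.
by exists Y => //; rewrite setTI.
Qed.

Lemma measurable_fun_coordP d1 (T1 : measurableType d1) (f : T1 -> 'rV[T]_n) :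
  measurable_fun [set: T1] f <->
  forall i, measurable_fun [set: T1] (fun t => f t ord0 i : T).
Proof.
split=> [mf i|mf].
  exact: (measurableT_comp (measurable_coord i) mf).
move=> _ A mA; rewrite setTI.
suff : g_sigma_preimage coord `<=` [set B | measurable (f @^-1` B)] by exact.
apply: smallest_sub => [|B].
  split => /=.
  - by rewrite preimage_set0.
  - by move=> B mB; rewrite setTD preimage_setC; exact: measurableC.
  - by move=> F mF; rewrite preimage_bigcup; exact: bigcup_measurable.
rewrite -bigcup_seq => -[i _ [C mC <-]] /=.
by rewrite setTI -comp_preimage -[X in measurable X]setTI; exact: mf.
Qed.

End rV_measurable.

Section lebesgue_rV.
Context (R : realType).

Definition rV_cons n (p : measurableTypeR R * 'rV[R]_n) : 'rV[R]_n.+1 :=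
  row_mx (p.1%:M : 'rV[R]_1) p.2.

Lemma measurable_rV_cons n : measurable_fun [set: _] (@rV_cons n).
Proof.
apply/measurable_fun_coordP => i; rewrite /rV_cons.
case: (@split_ordP 1 n i) => j ->.
- rewrite [X in measurable_fun _ X](_ : _ = fst); first exact: measurable_fst.
  by apply/funext => p; rewrite (row_mxEl (p.1%:M : 'rV_1)) mxE (ord1 j) eqxx mulr1n.
- rewrite [X in measurable_fun _ X](_ : _ = (fun x : 'rV[R]_n => x ord0 j) \o snd).
    exact: (measurableT_comp (measurable_coord j) measurable_snd).
  by apply/funext => p; rewrite (row_mxEr (p.1%:M : 'rV_1)).
Qed.

Section step.
Context n (mu : {sigma_finite_measure set 'rV[R]_n -> \bar R}).

Definition lebesgue_rV_step : set 'rV[R]_n.+1 -> \bar R :=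
  pushforward (lebesgue_measure \x mu)%E (@rV_cons n).

Let step0 : lebesgue_rV_step set0 = 0%E.
Proof. by rewrite /lebesgue_rV_step /pushforward preimage_set0 measure0. Qed.

Let step_ge0 A : (0 <= lebesgue_rV_step A)%E.
Proof. by rewrite /lebesgue_rV_step /pushforward; exact: measure_ge0. Qed.

Let step_sigma_additive : semi_sigma_additive lebesgue_rV_step.
Proof.
apply: (@measure_semi_sigma_additive _ _ _ (pushforward _ _)).
exact: measurable_rV_cons.
Qed.

HB.instance Definition _ := isMeasure.Build _ _ _ lebesgue_rV_step
  step0 step_ge0 step_sigma_additive.

Let step_sigma_finite : sigma_finite setT lebesgue_rV_step.
Proof.
have /sigma_finiteP[F [FT ndF F_oo]] :=
  sigma_finiteT (@lebesgue_measure R).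
have /sigma_finiteP[G [GT ndG G_oo]] := sigma_finiteT mu.
pose g (x : 'rV[R]_n.+1) : measurableTypeR R * 'rV[R]_n :=
  (x ord0 ord0, rsubmx (x : 'rV_(1 + n))).
have gK p : g (rV_cons p) = p.
  case: p => a v; rewrite /g /rV_cons row_mxKr; congr (_, _).
  have -> : ord0 = lshift n (ord0 : 'I_1) :> 'I_(1 + n) by exact: val_inj.
  by rewrite (row_mxEl (a%:M : 'rV_1)) mxE eqxx mulr1n.
have mg : measurable_fun setT g.
  apply/measurable_fun_pairP; split; first exact: measurable_coord.
  apply/measurable_fun_coordP => i /=.
  under eq_fun do rewrite mxE.
  exact: measurable_coord.
exists (fun i => g @^-1` (F i `*` G i)) => [|i].
  apply/esym; rewrite -subTset => x _.
  have [[i _ Fi] [j _ Gj]] : (\bigcup_i F i) (g x).1 /\ (\bigcup_i G i) (g x).2.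
    by rewrite -FT -GT.
  exists (maxn i j) => //; split.
  - by move: Fi; exact/subsetPset/ndF/leq_maxl.
  - by move: Gj; exact/subsetPset/ndG/leq_maxr.
have [mF Foo] := F_oo i; have [mG Goo] := G_oo i; split.
  by rewrite -[X in measurable X]setTI; apply: mg => //; exact: measurableX.
rewrite /lebesgue_rV_step /pushforward -comp_preimage.
have -> : g \o @rV_cons n = id by apply/funext => p /=; rewrite gK.
by rewrite preimage_id product_measure1E// lte_mul_pinfty// ge0_fin_numE.
Qed.

HB.instance Definition _ := Measure_isSigmaFinite.Build _ _ _ lebesgue_rV_step
  step_sigma_finite.

End step.

Fixpoint lebesgue_rV n : {sigma_finite_measure set 'rV[R]_n -> \bar R} :=
  if n is m.+1 then lebesgue_rV_step (lebesgue_rV m)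
  else @dirac _ 'rV[R]_0 0 R.

End lebesgue_rV.

Section euclidean.
Context (R : realType).
Implicit Types n m k : nat.

Definition vol n (A : set 'rV[R]_n) : R := fine (lebesgue_rV R n A).

(* The library norm on ['rV_n] is the sup norm. *)
Definition enorm n (x : 'rV[R]_n) : R := Num.sqrt (\sum_i x ord0 i ^+ 2).

Definition eball n : set 'rV[R]_n := [set x | enorm x <= 1].
Arguments eball : clear implicits.

Definition esphere n : set 'rV[R]_n := [set x | enorm x = 1].
Arguments esphere : clear implicits.

Definition unitize n (x : 'rV[R]_n) : 'rV[R]_n := (enorm x)^-1 *: x.

Lemma measurable_enorm n : measurable_fun setT (@enorm n).
Proof.
rewrite [X in measurable_fun _ X](_ : _ =
  (@powR R ^~ 2^-1) \o (fun x : 'rV[R]_n => \sum_i x ord0 i ^+ 2)).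
  apply: measurableT_comp => //; apply: measurable_sum => i.
  exact: (measurable_funX 2 (measurable_coord i)).
by apply/funext => x /=; rewrite powR12_sqrt// sumr_ge0// => i _; rewrite sqr_ge0.
Qed.

Lemma measurable_eball n : measurable (eball n).
Proof.
rewrite (_ : eball _ = @enorm n @^-1` `]-oo, 1]).
  by rewrite -[X in measurable X]setTI; exact: measurable_enorm.
by apply/seteqP; split=> x /=; rewrite in_itv.
Qed.

Lemma measurable_unitize n : measurable_fun setT (@unitize n).
Proof.
apply/measurable_fun_coordP => i.
rewrite [X in measurable_fun _ X](_ : _ =
  (fun x => enorm x `^ (-1)) \* (fun x : 'rV[R]_n => x ord0 i)).
  apply: measurable_funM; last exact: measurable_coord.
  exact: (measurableT_comp (measurable_powR _) (@measurable_enorm n)).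
by apply/funext => x /=; rewrite !mxE powR_inv1// sqrtr_ge0.
Qed.

Section surface_measure.
Context n.

(* Unnormalized surface measure of the unit sphere, in polar coordinates: the
   measure of a set [A] of unit vectors is [n] times the volume of the cone
   of all [r *: u] with [0 < r <= 1] and [u] in [A]. It is the counting
   measure on the two unit vectors when [n = 1]. *)
Definition surface_measure (A : set 'rV[R]_n) : \bar R :=
  (n%:R%:E * lebesgue_rV R n (eball n `&` @unitize n @^-1` A))%E.

Let surface0 : surface_measure set0 = 0%E.
Proof. by rewrite /surface_measure preimage_set0 setI0 measure0 mule0. Qed.

Let surface_ge0 A : (0 <= surface_measure A)%E.
Proof. by rewrite /surface_measure mule_ge0// lee_fin. Qed.

Let surface_sigma_additive : semi_sigma_additive surface_measure.
Proof.
pose nu : {measure set 'rV[R]_n -> \bar R} := mscale (NngNum (ler0n R n))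
  (mrestr (lebesgue_rV R n) (@measurable_eball n)).
have nuE : surface_measure = pushforward nu (@unitize n).
  by apply/funext => A; rewrite /surface_measure setIC.
rewrite nuE; apply: (@measure_semi_sigma_additive _ _ _ (pushforward nu _)).
exact: measurable_unitize.
Qed.

HB.instance Definition _ := isMeasure.Build _ _ _ surface_measure
  surface0 surface_ge0 surface_sigma_additive.

End surface_measure.
Arguments surface_measure : clear implicits.

Section subspaces.
Context (n m : nat).
Implicit Types H : {vspace 'rV[R]_n}.

(* The rows of [U] form an orthonormal basis of [H]. *)
Definition orthonormal_frame H : set 'M[R]_(m, n) :=
  [set U | U *m U^T = 1%:M /\
    forall x : 'rV[R]_n, x \in H <-> exists y : 'rV[R]_m, x = y *m U].

Definition frame H : 'M[R]_(m, n) := get (orthonormal_frame H).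

Definition embed H (y : 'rV[R]_m) : 'rV[R]_n := y *m frame H.

Lemma measurable_embed H : measurable_fun setT (embed H).
Proof.
apply/measurable_fun_coordP => i.
under eq_fun do rewrite mxE.
apply: measurable_sum => j; apply: measurable_funM => //.
exact: measurable_coord.
Qed.

(* [mu] carried over from ['rV_m] to [H], as a measure on ['rV_n] concentrated
   on [H]. For the Lebesgue and surface measures, which are invariant under
   orthogonal maps, this does not depend on the choice of the frame. *)
Definition on_subspace (mu : {measure set 'rV[R]_m -> \bar R}) H :
  set 'rV[R]_n -> \bar R := pushforward mu (embed H).

Section on_subspace_measure.
Context (mu : {measure set 'rV[R]_m -> \bar R}) H.

Let on_subspace0 : on_subspace mu H set0 = 0%E.
Proof. by rewrite /on_subspace /pushforward preimage_set0 measure0. Qed.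

Let on_subspace_ge0 A : (0 <= on_subspace mu H A)%E.
Proof. by rewrite /on_subspace /pushforward; exact: measure_ge0. Qed.

Let on_subspace_sigma_additive : semi_sigma_additive (on_subspace mu H).
Proof.
apply: (@measure_semi_sigma_additive _ _ _ (pushforward mu _)).
exact: measurable_embed.
Qed.

HB.instance Definition _ := isMeasure.Build _ _ _ (on_subspace mu H)
  on_subspace0 on_subspace_ge0 on_subspace_sigma_additive.

End on_subspace_measure.
End subspaces.

Lemma orthonormal_frame_exists n m (H : {vspace 'rV[R]_n}) :
  \dim H = m -> exists U, orthonormal_frame (m := m) H U.
Proof.
elim: m => [|m IHm] in H * => dimH.
  exists 0; split=> [|x]; first by apply/matrixP => -[].
  move/eqP: dimH; rewrite dimv_eq0 => /eqP ->; rewrite memv0.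
  by split=> [/eqP->|[y ->]]; [exists 0|]; rewrite mulmx0.
have H_neq0 : H != 0%VS by rewrite -dimv_eq0 dimH.
set v := vpick H; pose H' := (H :\: <[v]>)%VS.
have v_neq0 : v != 0 by rewrite vpick0.
have vH : v \in H by exact: memv_pick.
have dimH' : \dim H' = m.
  have /eqP := dimv_cap_compl H <[v]>; rewrite dimH.
  have -> : (H :&: <[v]>)%VS = <[v]>%VS by apply/capv_idPr; rewrite -memvE.
  by rewrite dim_vline v_neq0 add1n eqSS => /eqP.
have [U' [U'1 U'H]] := IHm _ dimH'.
pose w := v - v *m U'^T *m U'.
have wU' : w *m U'^T = 0 by rewrite mulmxBl -!mulmxA U'1 mulmx1 subrr.
have H'H : (H' <= H)%VS by exact: diffvSl.
have pH' : v *m U'^T *m U' \in H' by apply/U'H; exists (v *m U'^T).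
have w_neq0 : w != 0.
  apply: contra_neq v_neq0 => /eqP; rewrite subr_eq0 => /eqP vE.
  have : v \in (H' :&: <[v]>)%VS by rewrite memv_cap memv_line andbT vE.
  by rewrite capv_diff memv0 => /eqP.
have wH : w \in H by rewrite rpredB// (subvP H'H).
have wwT : w *m w^T = (enorm w ^+ 2)%:M.
  apply/matrixP => i j; rewrite !ord1 [RHS]mxE eqxx mulr1n sqr_sqrtr.
    by rewrite mxE; apply: eq_bigr => k _; rewrite [_^T _ _]mxE expr2.
  by rewrite sumr_ge0// => k _; rewrite sqr_ge0.
have nw_neq0 : enorm w != 0.
  apply: contra_neq w_neq0 => /eqP.
  rewrite sqrtr_eq0 => le0; apply/rowP => k; rewrite [RHS]mxE.
  have : \sum_i w ord0 i ^+ 2 == 0.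
    by rewrite eq_le le0 sumr_ge0// => i _; rewrite sqr_ge0.
  rewrite psumr_eq0 => [|i _]; last exact: sqr_ge0.
  by move=> /allP/(_ k (mem_index_enum _)) /=; rewrite sqrf_eq0 => /eqP.
pose u := (enorm w)^-1 *: w.
exists (col_mx u U' : 'M[R]_(1 + m, n)); split.
  have uU' : u *m U'^T = 0 by rewrite -scalemxAl wU' scaler0.
  have uuT : u *m u^T = 1%:M.
    rewrite linearZ -scalemxAl -scalemxAr scalerA wwT scale_scalar_mx.
    by rewrite -invfM -expr2 mulVf// expf_neq0.
  have U'u : U' *m u^T = 0 by rewrite -[LHS]trmxK trmx_mul trmxK uU' trmx0.
  transitivity (col_mx u U' *m row_mx u^T U'^T); first by rewrite -tr_col_mx.
  by rewrite mul_col_row uuT uU' U'u U'1 -scalar_mx_block.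
have uH : u \in H by rewrite rpredZ.
have wE : w = enorm w *: u by rewrite scalerA divff// scale1r.
move=> x; split=> [xH|[y ->]]; last first.
  rewrite -[y](@hsubmxK _ 1 1 m) (@mul_row_col _ 1 1 m) rpredD//.
    by rewrite [lsubmx _]mx11_scalar mul_scalar_mx rpredZ.
  by rewrite (subvP H'H)//; apply/U'H; exists (rsubmx (y : 'rV_(1 + m))).
have : x \in (H' + <[v]>)%VS by rewrite addv_diff (subvP (addvSl _ _)).
move=> /memv_addP[h /U'H[z ->] [_ /vlineP[c ->] ->]].
exists (row_mx ((c * enorm w)%:M : 'rV_1) (z + c *: (v *m U'^T))).
rewrite (@mul_row_col _ 1 1 m) mul_scalar_mx -scalerA -wE mulmxDl -scalemxAl.
by rewrite [LHS]addrC addrCA -scalerDr subrK addrC.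
Qed.

Lemma frameP n m (H : {vspace 'rV[R]_n}) :
  \dim H = m -> orthonormal_frame H (frame m H).
Proof. by move=> /orthonormal_frame_exists[U HU]; exact: (getI HU). Qed.

Definition grassmannian n m := {H : {vspace 'rV[R]_n} | \dim H == m}.

Definition density_measure n (f : 'rV[R]_n -> R) (B : set 'rV[R]_n) : \bar R :=
  (\int[lebesgue_rV R n]_(x in B) (f x)%:E)%E.

(* [mu (B `&` H)], for [mu] the measure with density [f] *)
Definition density_section n m (f : 'rV[R]_n -> R) (B : set 'rV[R]_n)
    (H : grassmannian n m) : \bar R :=
  (\int[on_subspace (lebesgue_rV R m) (\val H)]_(x in B `&` [set` \val H])
     (f x)%:E)%E.

(* On a closed bounded set the infimum is attained: it is the minimum. *)
Definition minkowski_functional n (K : set 'rV[R]_n) (x : 'rV[R]_n) : R :=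
  inf [set a : R | 0 <= a /\ exists2 y, K y & x = a *: y].

Definition boundary n (K : set 'rV[R]_n) : set 'rV[R]_n :=
  closure K `\` interior K.

Definition star_body n (K : set 'rV[R]_n) : Prop :=
  [/\ closed K /\ bounded_set K,
      forall u : 'rV[R]_n, u != 0 ->
        exists a b : 'rV[R]_n, a != b /\
          range (fun t : R => t *: u) `&` boundary K `\ 0 = [set a; b],
      interior K 0 &
      continuous (minkowski_functional K)].

Definition origin_symmetric n (K : set 'rV[R]_n) : Prop := K = -%R @` K.

(* The spherical Radon transform of a function on the unit sphere of ['rV_n];
   the values of [g] outside of the sphere are irrelevant. *)
Definition radon n m (g : 'rV[R]_n -> R) (H : grassmannian n m) : R :=
  \int[on_subspace (surface_measure m) (\val H)]_(x in
    esphere n `&` [set` \val H]) g x.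

Arguments radon {n} m g H.

Definition radon_range n m : set {uniform grassmannian n m -> R} :=
  [set h | exists2 g : 'rV[R]_n -> R,
     {within esphere n, continuous g} & h = radon m g].
Arguments radon_range : clear implicits.

(* Positive functionals on [radon_range], continuous for the sup norm; the
   values of [nu] outside of [radon_range] are irrelevant. *)
Definition positive_functional n m
    (nu : {uniform grassmannian n m -> R} -> R) : Prop :=
  let X := radon_range n m in
  [/\ forall (a : R) h1 h2, X h1 -> X h2 ->
        nu (a *: h1 + h2) = a * nu h1 + nu h2,
      {within X, continuous nu} &
      forall h, X h -> (forall H, 0 <= h H) -> 0 <= nu h].

Definition generalized_intersection_body n k (K : set 'rV[R]_n) : Prop :=
  [/\ star_body K, origin_symmetric K &
      exists2 nu, positive_functional (m := n - k) nu &
        forall g : 'rV[R]_n -> R, {within esphere n, continuous g} ->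
          \int[surface_measure n]_(x in esphere n)
            (minkowski_functional K x ^- k * g x) = nu (radon (n - k) g)].

Definition radon_constant n k : R :=
  vol (eball n) `^ ((n - k)%:R / n%:R) / vol (eball (n - k)).

End euclidean.

(* Main.v *)
Require Import Defs.
From mathcomp Require Import all_boot all_order all_algebra.
From mathcomp Require Import all_classical all_reals all_analysis.
From mathcomp Require Import measurable_realfun ring lra.

(** In polar coordinates about the origin, both measures become integrals over
    unit spheres. Let [rho_K u] be the radius of [K] in the direction [u], let
    [j = n - k - 1], and for every [i] let [M_i(K)(u)] be the integral of
    [r ^ i * f (r u)] over [0 < r <= rho_K u]. Then [mu K] is the integral of
    [M_(n-1)(K)] over the sphere, and the measure of the section of [K] by [H]
    is the Radon transform of [M_j(K)] at [H] ([density_measure_radial],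
    [density_section_radon]).

    Let [c] be the constant function whose Radon transform is [eps]. The
    hypothesis on sections says that [g = M_j(L) + c - M_j(K)] has a nonnegative
    Radon transform. This [g] is continuous on the sphere, so the positive
    functional attached to [K] yields that the integral of [rho_K ^ k * g] is
    nonnegative:
      [\int rho_K^k M_j(K) <= \int rho_K^k M_j(L) + c \int rho_K^k].

    Two inequalities turn this into the conclusion. First, the weight
    [r ^ k - rho_K ^ k] is nonpositive before [rho_K] and nonnegative after it,
    so pointwise
      [M_(n-1)(K) - rho_K^k M_j(K) <= M_(n-1)(L) - rho_K^k M_j(L)]
    ([moment_comparison]). Second, since [\int rho_K^n] is [n] times the volume
    of [K], Hoelder's inequality bounds [\int rho_K^k] by
    [n |B|^((n-k)/n) Vol(K)^(k/n)] ([integral_radius_pow_le]).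

    Behind this lie two facts. The polar formula [ge0_integral_polar] comes
    from the scaling of Lebesgue measure and Tonelli's theorem, because the
    surface measure is defined through cones over the unit ball. And a star
    body is star-shaped ([star_body_segment]): a ray that left [K] and
    entered it again would give its line a third boundary point. *)

Set Implicit Arguments.
Unset Strict Implicit.
Unset Printing Implicit Defensive.

Import Order.TTheory GRing.Theory Num.Theory.
Import numFieldNormedType.Exports.

Local Open Scope classical_set_scope.
Local Open Scope ring_scope.

Local Arguments eball R n : clear implicits.
Local Arguments esphere R n : clear implicits.
Local Arguments surface_measure R n A : clear implicits.

(** * Borel measurability on row vectors *)

Section measurability.
Context (R : realType).
Implicit Types (n : nat).

(** An open set is the union of the countably many rational boxes inside it. *)
Lemma open_measurable_rV n (A : set 'rV[R]_n) : open A -> measurable A.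
Proof.
move=> oA.
pose box (p : 'rV[rat]_n * 'rV[rat]_n) : set 'rV[R]_n :=
  \bigcap_(i in [set: 'I_n]) ((fun x : 'rV[R]_n => x ord0 i) @^-1`
    `]ratr (p.1 ord0 i), ratr (p.2 ord0 i)[).
pose F p := if `[< box p `<=` A >] then box p else set0.
suff -> : A = \bigcup_p F p.
  apply: countable_bigcupT_measurable; first exact: countableP.
  move=> p; rewrite /F; case: asboolP => // _.
  apply: fin_bigcap_measurable => // i _.
  by rewrite -[X in measurable X]setTI; exact: measurable_coord.
apply/seteqP; split => [x Ax|x [p _]]; last first.
  by rewrite /F; case: asboolP => // pA; exact: pA.
have /nbhs_ballP[e /= e0 xeA] : nbhs x A by exact: open_nbhs_nbhs.
have /choice[q qP] (i : 'I_n) : exists q : rat, ratr q \in `]x ord0 i - e, x ord0 i[.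
  by apply: rat_in_itvoo; rewrite ltrBlDr ltrDl.
have /choice[r rP] (i : 'I_n) : exists q : rat, ratr q \in `]x ord0 i, x ord0 i + e[.
  by apply: rat_in_itvoo; rewrite ltrDl.
exists (\row_i q i, \row_i r i) => //.
rewrite /F asboolT => [i _ /=|y yb].
  rewrite !mxE in_itv/=; have := qP i; have := rP i.
  by rewrite !in_itv/= => /andP[-> _] /andP[_ ->].
apply: xeA; split => // i j; rewrite (ord1 i) /ball/=.
have := yb j I; have := qP j; have := rP j.
rewrite /= !mxE !in_itv/= => /andP[r1 r2] /andP[q1 q2] /andP[y1 y2].
by rewrite ltr_distlC; apply/andP; split; [exact: lt_trans y1|exact: lt_trans r2].
Qed.

Lemma closed_measurable_rV n (A : set 'rV[R]_n) : closed A -> measurable A.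
Proof.
move=> cA; rewrite -[A]setCK; apply: measurableC.
by apply: open_measurable_rV; exact: closed_openC.
Qed.

Lemma within_continuous_measurable_rV n (D : set 'rV[R]_n) (g : 'rV[R]_n -> R) :
  measurable D -> {within D, continuous g} -> measurable_fun D g.
Proof.
move=> mD /continuousP cg; apply: (measurability _ (RGenOpens.measurableE R)).
move=> _ [_ [a [b ->] <-]].
have /open_subspaceP[V oV VE] := cg _ (@interval_open R (BRight a) (BLeft b) isT isT).
by rewrite setIC -VE; apply: measurableI => //; exact: open_measurable_rV.
Qed.

Lemma continuous_measurable_rV n (g : 'rV[R]_n -> R) :
  continuous g -> measurable_fun setT g.
Proof.
by move=> cg; apply: within_continuous_measurable_rV => //; exact: continuous_subspaceT.
Qed.

Lemma measurable_scale_pair n :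
  measurable_fun setT (fun p : 'rV[R]_n * measurableTypeR R => (p.2 : R) *: p.1).
Proof.
apply/measurable_fun_coordP => i.
under eq_fun do rewrite mxE.
apply: measurable_funM; first exact: measurable_snd.
exact: (measurableT_comp (measurable_coord i) measurable_fst).
Qed.

Lemma measurable_scale n (s : R) : measurable_fun setT (fun x : 'rV[R]_n => s *: x).
Proof.
apply/measurable_fun_coordP => i.
under eq_fun do rewrite mxE.
by apply: measurable_funM => //; exact: measurable_coord.
Qed.

End measurability.

(** * Scaling of Lebesgue measure *)

Section scaling.
Context (R : realType).
Implicit Types (n : nat).
Local Notation leb := (@lebesgue_measure R).

(** Multiplication by [s] stretches intervals by [s], and a measure with the
    right values on intervals is Lebesgue measure. *)
Lemma ge0_integral_scale1 (s : R) (F : R -> \bar R) : 0 < s ->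
  measurable_fun setT F -> (forall x, 0 <= F x)%E ->
  (\int[leb]_x F x = s%:E * \int[leb]_x F (s * x)%R)%E.
Proof.
move=> s0 mF F0.
have ms : measurable_fun setT ( *%R s : measurableTypeR R -> measurableTypeR R).
  exact: mulrl_measurable.
(* the measure structure of a push-forward is indexed by a proof that the map is
   measurable, so [nu] takes that proof as its argument *)
pose nu : {measure set (measurableTypeR R) -> \bar R} :=
  mscale (NngNum (ltW s0)) (pushforward leb ( *%R s : measurableTypeR R -> measurableTypeR R)).
have nuE A : measurable A -> leb A = nu ms A.
  move: A; apply: lebesgue_measure_unique => _ [[a b] _ <-] /=.
  rewrite /nu /mscale/= /pushforward.
  have -> : ( *%R s) @^-1` `]a, b] = `]s^-1 * a, s^-1 * b]%classic :> set R.
    apply/seteqP; split => x /=; rewrite !in_itv/= ltr_pdivrMl// ler_pdivlMl//.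
  rewrite !lebesgue_measure_itv/= !lte_fin ltr_pM2l ?invr_gt0//.
  case: ifPn => ab; last by rewrite mule0.
  by rewrite -EFinB -EFinM -mulrBr mulrA divff ?mul1r ?gt_eqF.
transitivity (\int[nu ms]_x F x)%E; first by apply: eq_measure_integral => A mA _; exact: nuE.
rewrite ge0_integral_mscale//; congr (_ * _)%E.
by rewrite ge0_integral_pushforward.
Qed.

(** Tonelli for the recursive definition of Lebesgue measure: this is how
    one-dimensional facts propagate to ['rV_n]. *)
Lemma ge0_integral_rVS n (F : 'rV[R]_n.+1 -> \bar R) :
  measurable_fun setT F -> (forall x, 0 <= F x)%E ->
  (\int[lebesgue_rV R n.+1]_x F x =
   \int[lebesgue_rV R n]_y \int[leb]_a F (rV_cons (a, y)))%E.
Proof.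
move=> mF F0.
transitivity (\int[leb \x lebesgue_rV R n]_p F (rV_cons p))%E.
  rewrite /= /lebesgue_rV_step.
  by rewrite (ge0_integral_pushforward (@measurable_rV_cons R n)).
rewrite fubini_tonelli2//.
by apply: measurableT_comp => //; exact: measurable_rV_cons.
Qed.

Lemma ge0_integral_scale n (s : R) (F : 'rV[R]_n -> \bar R) : 0 < s ->
  measurable_fun setT F -> (forall x, 0 <= F x)%E ->
  (\int[lebesgue_rV R n]_x F x =
   (s ^+ n)%:E * \int[lebesgue_rV R n]_x F (s *: x))%E.
Proof.
move=> s0; elim: n F => [|n IHn] F mF F0.
  rewrite expr0 mul1e; apply: eq_integral => x _.
  by congr F; apply/rowP => -[].
have mFs : measurable_fun setT (fun x : 'rV[R]_n.+1 => F (s *: x)).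
  by apply: measurableT_comp => //; exact: measurable_scale.
have mFc : measurable_fun setT (F \o @rV_cons R n).
  by apply: measurableT_comp => //; exact: measurable_rV_cons.
have mG : measurable_fun setT (fun y => \int[leb]_a F (rV_cons (a, y)))%E.
  apply: (measurable_fun_fubini_tonelli_G (m1 := leb) (F \o @rV_cons R n)) => // p.
  exact: F0.
rewrite ge0_integral_rVS// ge0_integral_rVS//.
rewrite IHn//; last by move=> y; apply: integral_ge0.
rewrite exprSr EFinM -muleA; congr (_ * _)%E.
rewrite -ge0_integralZl//; last 3 first.
- apply: (measurable_fun_fubini_tonelli_G (m1 := leb)
    ((fun x => F (s *: x)) \o @rV_cons R n)) => [|p]; last exact: F0.
  by apply: (measurableT_comp mFs); exact: measurable_rV_cons.
- by move=> y _; apply: integral_ge0.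
- by rewrite lee_fin ltW.
apply: eq_integral => y _.
rewrite (ge0_integral_scale1 s0)//; last first.
  by apply: (measurableT_comp mFc); exact: measurable_pair2.
congr (_ * _)%E; apply: eq_integral => a _; congr F.
rewrite /rV_cons -scale_scalar_mx; apply/esym.
exact: (@scale_row_mx R 1 1 n s).
Qed.

End scaling.

(** * Cubes and the Euclidean ball *)

Section cubes_and_balls.
Context (R : realType).
Implicit Types (n : nat).

(** Cubes have an explicit volume for the product measure. They serve to show
    that [{0}] is null, and that balls and star bodies have finite and positive
    volume. *)
Definition cube n (a : R) : set 'rV[R]_n := [set x | forall i, `|x ord0 i| <= a].
Arguments cube : clear implicits.

Lemma measurable_cube n a : measurable (cube n a).
Proof.
rewrite [X in measurable X](_ : _ = \bigcap_(i in [set: 'I_n])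
    (fun x : 'rV[R]_n => x ord0 i) @^-1` `[- a, a]); last first.
  by apply/seteqP; split => x xa i; move: (xa i); rewrite /= in_itv/= ler_norml//; exact.
apply: fin_bigcap_measurable => // i _.
by rewrite -[X in measurable X]setTI; exact: measurable_coord.
Qed.

Lemma lebesgue_cube n (a : R) : 0 <= a ->
  lebesgue_rV R n (cube n a) = ((2 * a) ^+ n)%:E.
Proof.
move=> a0; elim: n => [|n IHn].
  rewrite (_ : cube 0 a = setT) ?expr0; first exact: diracT.
  by apply/seteqP; split => // x _ [].
rewrite [LHS]/= /lebesgue_rV_step /pushforward.
have -> : @rV_cons R n @^-1` cube n.+1 a = `[- a, a]%classic `*` cube n a.
  apply/seteqP; split => [[t y] h|[t y] [/= ta ya] i].
    split => [|i]/=.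
      have := h (lshift n (ord0 : 'I_1)).
      by rewrite /rV_cons (row_mxEl (t%:M : 'rV_1)) mxE eqxx mulr1n in_itv/= ler_norml.
    by have := h (rshift 1 i); rewrite /rV_cons (row_mxEr (t%:M : 'rV_1)).
  rewrite /rV_cons; case: (@split_ordP 1 n i) => j ->.
    rewrite (row_mxEl (t%:M : 'rV_1)) mxE (ord1 j) eqxx mulr1n.
    by move: ta; rewrite in_itv/= ler_norml.
  by rewrite (row_mxEr (t%:M : 'rV_1)); exact: ya.
rewrite product_measure1E//; last exact: measurable_cube.
rewrite IHn exprS EFinM; congr (_ * _)%E.
rewrite [LHS](@lebesgue_measure_itv R `[- a, a])/= lte_fin -EFinB opprK.
case: ltP => [_|aa]; first by rewrite mulr_natl mulr2n.
by have -> : a = 0; [lra|rewrite mulr0].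
Qed.

Lemma cube0 n : cube n 0 = [set 0].
Proof.
apply/seteqP; split => [x x0|x -> i]; last by rewrite mxE normr0.
by apply/rowP => i; rewrite mxE; apply/eqP; rewrite -normr_le0; exact: x0.
Qed.

Lemma measurable_singleton0 n : measurable [set 0 : 'rV[R]_n].
Proof. by rewrite -cube0; exact: measurable_cube. Qed.

Lemma lebesgue_singleton0 n : (0 < n)%N -> lebesgue_rV R n [set 0] = 0.
Proof. by move=> n0; rewrite -cube0 lebesgue_cube// mulr0 expr0n gtn_eqF. Qed.

Lemma enorm0 n : enorm (0 : 'rV[R]_n) = 0.
Proof. by rewrite /enorm big1 ?sqrtr0// => i _; rewrite mxE expr0n. Qed.

Lemma enorm_ge0 n (x : 'rV[R]_n) : 0 <= enorm x.
Proof. exact: sqrtr_ge0. Qed.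

Lemma enorm_sqr n (x : 'rV[R]_n) : enorm x ^+ 2 = \sum_i x ord0 i ^+ 2.
Proof. by rewrite sqr_sqrtr// sumr_ge0// => i _; exact: sqr_ge0. Qed.

Lemma coord_le_enorm n (x : 'rV[R]_n) i : `|x ord0 i| <= enorm x.
Proof.
rewrite -(@ler_pXn2r _ 2) ?nnegrE ?enorm_ge0// enorm_sqr real_normK ?num_real// (bigD1 i)//=.
by rewrite lerDl sumr_ge0// => j _; exact: sqr_ge0.
Qed.

Lemma enorm_eq0 n (x : 'rV[R]_n) : (enorm x == 0) = (x == 0).
Proof.
apply/eqP/eqP => [x0|->]; last exact: enorm0.
apply/rowP => i; rewrite mxE; apply/eqP; rewrite -normr_le0 -x0.
exact: coord_le_enorm.
Qed.

Lemma enorm_gt0 n (x : 'rV[R]_n) : (0 < enorm x) = (x != 0).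
Proof. by rewrite lt_def enorm_eq0 enorm_ge0 andbT. Qed.

Lemma enormZ n (s : R) (x : 'rV[R]_n) : enorm (s *: x) = `|s| * enorm x.
Proof.
rewrite /enorm -sqrtr_sqr -sqrtrM ?sqr_ge0// mulr_sumr.
by congr Num.sqrt; apply: eq_bigr => i _; rewrite mxE exprMn.
Qed.

Lemma enorm_unitize n (x : 'rV[R]_n) : x != 0 -> enorm (unitize x) = 1.
Proof.
move=> x0; rewrite enormZ ger0_norm ?invr_ge0 ?enorm_ge0//.
by rewrite mulVf// enorm_eq0.
Qed.

Lemma enorm_continuous n : continuous (@enorm R n).
Proof.
have c : continuous (fun x : 'rV[R]_n => \sum_i x ord0 i ^+ 2).
  apply: continuous_big => [|i _ x]; first exact: add_continuous.
  apply: (@continuous_comp _ _ _ (fun x : 'rV[R]_n => x ord0 i) (fun t : R => t ^+ 2)).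
    exact: coord_continuous.
  exact: exprn_continuous.
by move=> x; apply: continuous_comp; [exact: c|exact: sqrt_continuous].
Qed.

Lemma lebesgue_eball_fin_num n : lebesgue_rV R n (eball R n) \is a fin_num.
Proof.
rewrite ge0_fin_numE//; apply: (@le_lt_trans _ _ (lebesgue_rV R n (cube n 1))).
  apply: le_measure; rewrite ?inE.
  - exact: measurable_eball.
  - exact: measurable_cube.
  - by move=> x /= x1 i; exact: le_trans (coord_le_enorm _ _) x1.
by rewrite lebesgue_cube// ltry.
Qed.

(** The cube of half-side [1 / (n + 1)] lies in the unit ball. *)
Lemma vol_eball_gt0 n : 0 < vol (eball R n).
Proof.
rewrite fine_gt0// ltey_eq lebesgue_eball_fin_num andbT.
pose a : R := n.+1%:R^-1.
apply: (@lt_le_trans _ _ (lebesgue_rV R n (cube n a))).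
  by rewrite lebesgue_cube ?invr_ge0// lte_fin exprn_gt0// mulr_gt0// invr_gt0.
apply: le_measure; rewrite ?inE.
- exact: measurable_cube.
- exact: measurable_eball.
move=> x xa; rewrite /eball/= -(@ler_pXn2r _ 2) ?nnegrE ?enorm_ge0// expr1n enorm_sqr.
apply: (@le_trans _ _ (\sum_(i < n) a ^+ 2)).
  apply: ler_sum => i _; rewrite -[leLHS]real_normK ?num_real// ler_pXn2r ?nnegrE ?invr_ge0//.
rewrite sumr_const card_ord -mulr_natl -[leRHS](@divff _ n.+1%:R)//.
rewrite expr2 mulrA ler_pM2r ?invr_gt0//.
rewrite ler_pdivrMr// -natrM ler_nat.
by rewrite mulSn -addn1 -addnA leq_addr.
Qed.

End cubes_and_balls.
Arguments cube {R} n a.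

(** * Polar coordinates *)

Section surface.
Context (R : realType).
Implicit Types (n : nat).
Local Notation leb := (@lebesgue_measure R).

Lemma ge0_integral_mrestr d (T : measurableType d) (mu : {measure set T -> \bar R})
    (B D : set T) (mB : measurable B) (mD : measurable D) (f : T -> \bar R) :
  measurable_fun D f -> (forall x, D x -> 0 <= f x)%E ->
  (\int[mrestr mu mB]_(x in D) f x = \int[mu]_(x in D `&` B) f x)%E.
Proof.
move=> mf f0; rewrite [LHS](ge0_negligible_integral (measurableC mB))//; last first.
  by rewrite /= /mrestr setIC setICr measure0.
rewrite setDE setCK; apply: eq_measure_integral => A mA AB.
rewrite [LHS]/= /mrestr setIidl//.
by apply: (subset_trans AB) => x [].
Qed.

Lemma measurable_esphere n : measurable (esphere R n).
Proof.
rewrite [X in measurable X](_ : _ = @enorm R n @^-1` [set 1]) //.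
by rewrite -[X in measurable X]setTI; exact: measurable_enorm.
Qed.

(** The surface measure is [n] times the image under [unitize] of Lebesgue
    measure on the unit ball; integrating over the sphere discards the origin,
    the only point of the ball that [unitize] sends off the sphere. *)
Lemma ge0_integral_surface n (G : 'rV[R]_n -> \bar R) :
  measurable_fun (esphere R n) G -> (forall u, esphere R n u -> 0 <= G u)%E ->
  (\int[surface_measure R n]_(u in esphere R n) G u =
   n%:R%:E * \int[lebesgue_rV R n]_(x in eball R n `\ 0%R) G (unitize x))%E.
Proof.
move=> mG G0.
pose nu : {measure set 'rV[R]_n -> \bar R} :=
  mscale (NngNum (ler0n R n))
    (pushforward (mrestr (lebesgue_rV R n) (@measurable_eball R n)) (@unitize R n)).
pose mU := @measurable_unitize R n.
transitivity (\int[nu mU]_(u in esphere R n) G u)%E.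
  apply: eq_measure_integral => A mA _.
  by rewrite [RHS]/= /mscale/= /pushforward /mrestr setIC.
have mS := @measurable_esphere n.
rewrite ge0_integral_mscale//; congr (_ * _)%E.
rewrite (ge0_integral_pushforward mU)//; last by move=> u; rewrite inE; exact: G0.
have mUS : measurable (@unitize R n @^-1` esphere R n).
  by rewrite -[X in measurable X]setTI; exact: mU.
rewrite ge0_integral_mrestr//; last 2 first.
- by apply: (measurable_comp mS) => //; [move=> _ [x Sx <-]|exact: measurable_funTS].
- by move=> x; exact: G0.
congr (integral _ _ _); apply/seteqP; split => x /= [].
  move=> ux xB; split => // x0; move: ux; rewrite x0 /unitize scaler0.
  by rewrite /esphere /= enorm0 => /eqP; rewrite eq_sym oner_eq0.
by move=> xB /eqP x0; split => //; exact: enorm_unitize.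
Qed.

Lemma integral_power_tail n (a : R) : (0 < n)%N -> 0 < a ->
  (\int[leb]_(s in `[a, +oo[) (n%:R * s ^- n.+1)%:E = (a ^- n)%:E)%E.
Proof.
move=> n0 a0.
have xn0 (x : R) : a < x -> x ^+ n != 0.
  by move=> ax; rewrite expf_neq0// gt_eqF// (lt_trans a0).
have dX (x : R) : is_derive x 1 (fun y : R => y ^+ n) (n%:R * x ^+ n.-1).
  have := @is_deriveX R R^o (id : R^o -> R) n x 1 1 (is_derive_id _ _).
  by rewrite exprfctE /GRing.scale/= mulr1.
rewrite (@ge0_continuous_FTC2y R (fun s => n%:R * s ^- n.+1) (fun s => - s ^- n) a 0).
- by rewrite -EFinB sub0r opprK.
- by move=> x ax; rewrite mulr_ge0// invr_ge0 exprn_ge0// (le_trans _ ax)// ltW.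
- apply: continuous_in_subspaceT => x; rewrite inE/= in_itv/= andbT => ax.
  have x0 : 0 < x by exact: lt_le_trans ax.
  apply: cvgM; first exact: cvg_cst.
  by apply: cvgV; [rewrite expf_neq0// gt_eqF|exact: exprn_continuous].
- rewrite -oppr0; apply: cvgN.
  have y_gt0 : \forall x \near +oo, 0 < (x : R) ^+ n.
    by near=> x; rewrite exprn_gt0//; near: x; exact: nbhs_pinfty_gt.
  have y_ge : \forall x \near +oo, (x : R) <= x ^+ n.
    by near=> x; rewrite -[leLHS]expr1; apply: ler_weXn2l.
  by apply/(gtr0_cvgV0 y_gt0)/(ger_cvgy y_ge); exact: cvg_id.
- by move=> x ax; apply: derivableN; apply: derivableV; [exact: xn0|].
- apply: cvgN; apply: cvgV; first by rewrite expf_neq0// gt_eqF.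
  by apply: cvg_at_right_filter; exact: exprn_continuous.
- move=> x; rewrite in_itv/= andbT => ax.
  rewrite derive1E deriveN; last by apply: derivableV; [exact: xn0|].
  rewrite deriveV ?xn0// derive_val scaleNr opprK.
  rewrite /GRing.scale/= -(prednK n0)/= exprS.
  have x0 : x != 0 by rewrite gt_eqF// (lt_trans a0).
  have xn : x ^+ n.-1 != 0 by rewrite expf_neq0.
  rewrite !exprS; field.
  by rewrite xn x0.
Unshelve. all: by end_near. Qed.

End surface.

Section polar.
Context (R : realType).
Local Notation leb := (@lebesgue_measure R).

Lemma measurable_radial_integrand n m (F : 'rV[R]_n -> \bar R) :
  measurable_fun setT F ->
  measurable_fun setT (fun p : 'rV[R]_n * measurableTypeR R =>
    (\1_(`]0%R, +oo[) (p.2 : R) * (p.2 : R) ^+ m)%:E * F ((p.2 : R) *: p.1))%E.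
Proof.
move=> mF; apply: emeasurable_funM.
  apply/measurable_EFinP; apply: measurable_funM.
    by apply: (@measurableT_comp _ _ _ _ _ _
      (\1_(`]0%R, +oo[) : measurableTypeR R -> R) _ snd).
  by apply: measurable_funX; exact: measurable_snd.
exact: (measurableT_comp mF (@measurable_scale_pair R n)).
Qed.

(** Polar coordinates from scaling and Tonelli. With [N := n.+1], the
    right-hand side is [N] times the integral over [x] in the unit ball of
    [\int r ^ n * F (r x / |x|) dr]. Substituting [r = s |x|] turns the latter
    into [|x| ^ N * \int s ^ n * F (s x) ds]. Now exchange the integrals and
    substitute [y = s x]: the total is the integral over [y] of
    [F y * |y| ^ N * \int_(s >= |y|) N / s ^ (N + 1) ds], and the last
    integral is [|y| ^ - N]. *)
Lemma ge0_integral_polar n (F : 'rV[R]_n.+1 -> \bar R) :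
  measurable_fun setT F -> (forall x, 0 <= F x)%E ->
  (\int[lebesgue_rV R n.+1]_x F x =
   \int[surface_measure R n.+1]_(u in esphere R n.+1)
     \int[leb]_r ((\1_(`]0%R, +oo[) r * r ^+ n)%:E * F (r *: u)))%E.
Proof.
move=> mF F0.
pose w (r : R) : R := \1_(`]0%R, +oo[) r * r ^+ n.
have w0 r : 0 <= w r.
  rewrite /w indicE; case: (boolP (r \in _)) => [|_]; last by rewrite mul0r.
  by rewrite inE/= in_itv/= andbT mul1r => /ltW r0; exact: exprn_ge0.
pose H (p : 'rV[R]_n.+1 * measurableTypeR R) := ((w p.2)%:E * F ((p.2 : R) *: p.1))%E.
have mH : measurable_fun setT H by exact: measurable_radial_integrand.
have H0 p : (0 <= H p)%E by rewrite mule_ge0// lee_fin.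
pose G u := (\int[leb]_r H (u, r))%E.
have mG : measurable_fun setT G.
  exact: (measurable_fun_fubini_tonelli_F (m2 := leb) H).
have G0 u : (0 <= G u)%E by apply: integral_ge0.
apply/esym.
rewrite (ge0_integral_surface (G := G))//; last exact: measurable_funTS.
(* the substitution [r = s * enorm x] *)
have Gunit x : x != 0 -> (G (unitize x) = (enorm x ^+ n.+1)%:E * G x)%E.
  move=> x0; have x_gt0 : 0 < enorm x by rewrite enorm_gt0.
  rewrite /G (ge0_integral_scale1 x_gt0)//; last first.
    by apply: measurableT_comp => //; exact: measurable_pair1.
  rewrite exprS EFinM -muleA; congr (_ * _)%E.
  rewrite -ge0_integralZl//; last 2 first.
  - by apply: measurableT_comp => //; exact: measurable_pair1.
  - by rewrite lee_fin exprn_ge0// enorm_ge0.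
  apply: eq_integral => r _; rewrite /H/= muleA -EFinM.
  congr (_%:E * F _)%E; last by rewrite /unitize scalerA mulrAC divff ?gt_eqF// mul1r.
  rewrite /w exprMn mulrCA; congr (_ * _); congr (_ * _).
  rewrite !indicE; congr ((_ : bool)%:R).
  by apply/idP/idP; rewrite !inE/= !in_itv/= !andbT pmulr_rgt0.
pose b (x : 'rV[R]_n.+1) : R := \1_(eball R n.+1) x * enorm x ^+ n.+1.
have b0 x : 0 <= b x by rewrite mulr_ge0// exprn_ge0// enorm_ge0.
have mb : measurable_fun setT b.
  apply: measurable_funM; first by apply: measurable_indic; exact: measurable_eball.
  by apply: measurable_funX; exact: measurable_enorm.
have -> : (\int[lebesgue_rV R n.+1]_(x in eball R n.+1 `\ 0%R) G (unitize x) =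
    \int[lebesgue_rV R n.+1]_x \int[leb]_s ((b x)%:E * H (x, s)))%E.
  rewrite integral_mkcond; apply: eq_integral => x _.
  rewrite ge0_integralZl// ?lee_fin//; last first.
    by apply: measurableT_comp => //; exact: measurable_pair1.
  rewrite patchE; case: ifPn => [|].
    by rewrite inE/= => -[xB /eqP x0]; rewrite Gunit// /b indicE mem_set// mul1r.
  rewrite notin_setE /b => /not_andP[xB|/contrapT ->].
    by rewrite indicE memNset// mul0r mul0e.
  by rewrite enorm0 expr0n/= mulr0 mul0e.
rewrite (fubini_tonelli (fun p => (b p.1)%:E * H p)%E)/=; last 2 first.
- apply: emeasurable_funM => //; apply/measurable_EFinP.
  exact: (measurableT_comp mb measurable_fst).
- by move=> p; rewrite mule_ge0// lee_fin.
(* After [y = s *: x] the condition [enorm x <= 1] reads [enorm y <= s]. The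
   power of [s] is written with [powR] because it is measurable everywhere; it
   agrees with [s ^- n.+2] at [s > 0], and at [s <= 0] the kernel [k] vanishes. *)
pose D := [set p : 'rV[R]_n.+1 * measurableTypeR R | enorm p.1 <= p.2 :> R].
have mD : measurable D.
  rewrite -[D]setTI; apply: measurable_fun_le => //.
  exact: (measurableT_comp (@measurable_enorm R n.+1) measurable_fst).
pose k (p : 'rV[R]_n.+1 * measurableTypeR R) : R :=
  \1_D p * ((p.2 : R) `^ (- n.+2%:R)) * enorm p.1 ^+ n.+1.
have k0 p : 0 <= k p by rewrite !mulr_ge0// ?powR_ge0// exprn_ge0// enorm_ge0.
have mk : measurable_fun setT k.
  apply: measurable_funM.
    apply: measurable_funM; first exact: measurable_indic.
    exact: (measurableT_comp (measurable_powR _) measurable_snd).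
  exact: (measurable_funX _
    (measurableT_comp (@measurable_enorm R n.+1) measurable_fst)).
pose K p := ((k p)%:E * F p.1)%E.
have mK : measurable_fun setT K.
  apply: emeasurable_funM; first exact/measurable_EFinP.
  exact: (measurableT_comp mF measurable_fst).
have K0 p : (0 <= K p)%E by rewrite mule_ge0// lee_fin.
have powE s : 0 < s -> s `^ (- n.+2%:R) = s ^- n.+2.
  by move=> s0; rewrite powRN powR_mulrn// ltW.
transitivity (n.+1%:R%:E * \int[leb]_s \int[lebesgue_rV R n.+1]_y K (y, s))%E.
  congr (_ * _)%E; apply: eq_integral => s _.
  have [s_le0|s0] := leP s 0.
    rewrite !integral0_eq// => y _.
      rewrite /K /k/= indicE; have [->|y0] := eqVneq y 0.
        by rewrite enorm0 expr0n/= mulr0 mul0e.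
      rewrite memNset ?mul0r ?mul0e// /D/= => /le_trans/(_ s_le0).
      by apply/negP; rewrite -ltNge enorm_gt0.
    rewrite /H/w/= indicE memNset ?mul0r ?mul0e ?mule0//= in_itv/= andbT.
    by apply/negP; rewrite -leNgt.
  have mKs : measurable_fun setT (fun y => K (y, s)).
    by apply: measurableT_comp => //; exact: measurable_pair2.
  rewrite [RHS](ge0_integral_scale s0)//.
  rewrite -ge0_integralZl ?lee_fin ?exprn_ge0 ?ltW//; last first.
    exact: (measurableT_comp mKs (@measurable_scale R n.+1 s)).
  apply: eq_integral => y _; rewrite /H /K/= !muleA -!EFinM; congr (_%:E * _)%E.
  rewrite /b /w /k/= powE// enormZ gtr0_norm// exprMn.
  rewrite !indicE (mem_set (_ : `]0%R, +oo[%classic s)) ?mul1r/=; last first.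
    by rewrite in_itv/= s0.
  have -> : ((s *: y, s) \in D) = (y \in eball R n.+1).
    by apply/idP/idP; rewrite !inE /D /eball/= enormZ gtr0_norm// ger_pMr.
  have sn : s ^+ n != 0 by rewrite expf_neq0// gt_eqF.
  rewrite !exprS; field.
  by rewrite sn gt_eqF.
rewrite -(fubini_tonelli K)// -ge0_integralZl//; last 2 first.
- exact: (measurable_fun_fubini_tonelli_F (m2 := leb) K).
- by move=> y _; apply: integral_ge0.
(* the inner integral only has the right value at [y != 0] *)
have m0 := @measurable_singleton0 R n.+1.
have l0 := @lebesgue_singleton0 R n.+1 isT.
have mT := @measurable_fun_fubini_tonelli_F _ _ _ _ _ leb K mK K0.
rewrite [RHS](ge0_negligible_integral m0 measurableT mF (fun x _ => F0 x) l0).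
rewrite [LHS](ge0_negligible_integral m0 measurableT _ _ l0); first last.
- by move=> y _; rewrite mule_ge0// integral_ge0.
- by apply: emeasurable_funM => //; exact: mT.
apply: eq_integral => y; rewrite inE => -[_ /eqP y0].
have y_gt0 : 0 < enorm y by rewrite enorm_gt0.
pose c : \bar R := ((enorm y ^+ n.+1)%:E * F y)%E.
have c0 : (0 <= c)%E by rewrite mule_ge0// lee_fin exprn_ge0// ltW.
transitivity (\int[leb]_(s in `[enorm y, +oo[) (c * (n.+1%:R * s ^- n.+2)%:E))%E.
  rewrite [RHS]integral_mkcond -ge0_integralZl//; last first.
    by apply: measurableT_comp => //; exact: measurable_pair1.
  apply: eq_integral => s _; rewrite patchE /K /k/= indicE.
  have -> : ((y, s) \in D) = (s \in `[enorm y, +oo[%classic).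
    by apply/idP/idP; rewrite !inE /D/= in_itv/= andbT.
  case: ifPn => [|_]; last by rewrite !mul0r mul0e mule0.
  rewrite inE/= in_itv/= andbT => ys.
  rewrite mul1r powE ?(lt_le_trans y_gt0)// /c [RHS]muleC !muleA -!EFinM.
  by congr (_%:E * _)%E; rewrite mulrA.
rewrite ge0_integralZl//; last 2 first.
- apply/measurable_EFinP.
  apply: (eq_measurable_fun (fun s => n.+1%:R * s `^ (- n.+2%:R))).
    by move=> s; rewrite inE/= in_itv/= andbT => ys; rewrite powE// (lt_le_trans y_gt0).
  by apply: measurable_funTS; apply: measurable_funM => //; exact: measurable_powR.
- move=> s; rewrite /= in_itv/= andbT => ys; rewrite lee_fin mulr_ge0// invr_ge0.
  by rewrite exprn_ge0// ltW// (lt_le_trans y_gt0).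
rewrite integral_power_tail// /c muleAC -EFinM divff ?mul1e//.
by rewrite expf_neq0// gt_eqF.
Qed.

End polar.

(** * Star bodies along rays through the origin *)

Section star_bodies.
Context (R : realType) (n : nat).
Implicit Types (K : set 'rV[R]_n) (u v : 'rV[R]_n).

(** On a unit vector this is the distance from the origin to the boundary of a
    star body in that direction, see [radiusP]. *)
Definition radius K u : R := (minkowski_functional K u)^-1.

Section ray.
Variables (K : set 'rV[R]_n) (v : 'rV[R]_n).
Hypotheses (Kclosed : closed K) (Kbounded : bounded_set K) (K0 : interior K 0).
Hypothesis (v0 : v != 0).

Let ray_closed : closed [set t : R | K (t *: v)].
Proof. by apply: closed_comp => // t _; exact: scalel_continuous. Qed.

Lemma ray_bounded : exists2 M : R, 0 < M & forall t, 0 <= t -> K (t *: v) -> t <= M.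
Proof.
have v_gt0 : 0 < `|v| by rewrite normr_gt0.
have [M [_ KM]] := Kbounded.
exists ((`|M| + 1) / `|v|) => [|t t0 Kt]; first by rewrite divr_gt0// ltr_wpDl.
rewrite ler_pdivlMr// -{1}(ger0_norm t0) -normrZ.
by apply: KM Kt; rewrite (le_lt_trans (ler_norm _))// ltrDl.
Qed.

Lemma ray_interior (t : R) : interior K (t *: v) ->
  exists2 e : R, 0 < e & forall s, `|s - t| < e -> K (s *: v).
Proof.
move=> Kt.
have /nbhs_ballP[e /= e0 He] := @scalel_continuous _ _ v t _ Kt.
by exists e => // s st; apply: He; rewrite /ball/= distrC.
Qed.

(** The supremum of the [t] such that the whole segment up to [t *: v] stays in
    [K]; it is positive because the origin is interior. *)
Lemma ray_first_exit : exists p : R, [/\ 0 < p, boundary K (p *: v) &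
  forall s, 0 <= s -> s <= p -> K (s *: v)].
Proof.
pose T := [set t : R | 0 <= t /\ forall s, 0 <= s -> s <= t -> K (s *: v)].
have [e e0 Ke] : exists2 e : R, 0 < e & forall s, `|s - 0| < e -> K (s *: v).
  by apply: ray_interior; rewrite scale0r.
have Te : T (e / 2).
  split=> [|s s0 se]; first by rewrite divr_ge0// ltW.
  by apply: Ke; rewrite subr0 ger0_norm//; lra.
have [M M0 KM] := ray_bounded.
have ubT : has_ubound T by exists M => t [t0 Tt]; apply: KM => //; exact: Tt.
have T0 : T !=set0 by exists (e / 2).
pose p := sup T.
have pe : e / 2 <= p by exact: ub_le_sup.
have p0 : 0 < p by apply: lt_le_trans pe; rewrite divr_gt0.
have Ksub s : 0 <= s -> s <= p -> K (s *: v).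
  move=> s0; rewrite le_eqVlt => /predU1P[->|sp].
    apply: ray_closed; apply: (closure_subset _ (closure_sup T0 ubT)) => t [t0 Tt].
    exact: Tt.
  by have [t [t0 Tt] st] := sup_gt T0 sp; apply: Tt => //; exact: ltW.
exists p; split => //; split; first by apply: subset_closure; apply: Ksub => //; exact: ltW.
move=> /ray_interior[d d0 Kd].
suff : p + d / 2 <= p by move=> ?; lra.
apply: ub_le_sup => //; split=> [|s s0 sp]; first by lra.
have [sp'|ps] := leP s p; first exact: Ksub.
by apply: Kd; rewrite gtr0_norm ?subr_gt0//; lra.
Qed.

Lemma ray_last_exit (t : R) : 0 < t -> K (t *: v) ->
  exists2 q : R, t <= q & boundary K (q *: v).
Proof.
move=> t0 Kt; pose T := [set s : R | 0 <= s /\ K (s *: v)].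
have [M M0 KM] := ray_bounded.
have Tt : T t by split; first exact: ltW.
have ubT : has_ubound T by exists M => s [s0 Ks]; exact: KM.
have T0 : T !=set0 by exists t.
pose q := sup T.
have tq : t <= q by exact: ub_le_sup.
have Kq : K (q *: v).
  by apply: ray_closed; apply: (closure_subset _ (closure_sup T0 ubT)) => s [].
exists q => //; split; first exact: subset_closure.
move=> /ray_interior[d d0 Kd].
suff : q + d / 2 <= q by move=> ?; lra.
apply: ub_le_sup => //; split; first by lra.
by apply: Kd; rewrite addrAC subrr add0r gtr0_norm; lra.
Qed.

End ray.

(** If [K] missed [s *: v], the first exit along [v] would come before [s] and
    the last one after [t]; together with the first exit along [- v], the line
    would meet the boundary in three points other than the origin. *)
Lemma star_body_segment K v (s t : R) : star_body K -> v != 0 ->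
  0 < s -> s <= t -> K (t *: v) -> K (s *: v).
Proof.
move=> [[Kc Kb] Kline K0 _] v0 s0 st Kt; apply: contrapT => Ks.
have t0 : 0 < t by exact: lt_le_trans st.
have [p [p0 bp Kp]] := ray_first_exit Kc Kb K0 v0.
have [q tq bq] := ray_last_exit Kc Kb v0 t0 Kt.
have Nv0 : - v != 0 by rewrite oppr_eq0.
have [r [r0 + _]] := ray_first_exit Kc Kb K0 Nv0.
rewrite scalerN -scaleNr => br.
have ps : p < s.
  by rewrite ltNge; apply/negP => sp; apply: Ks; apply: Kp => //; exact: ltW.
have scale_inj (x y : R) : x *: v = y *: v -> x = y.
  move=> /eqP; rewrite -subr_eq0 -scalerBl scaler_eq0 (negbTE v0) orbF subr_eq0.
  by move=> /eqP.
have [a [b [_ abE]]] := Kline v v0.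
have in_ab (x : R) : x != 0 -> boundary K (x *: v) -> [set a; b] (x *: v).
  move=> x0 bx; rewrite -abE; split; first by split => //; exists x.
  by move=> /eqP; rewrite scaler_eq0 (negbTE v0) (negbTE x0).
have pab : [set a; b] (p *: v) by apply: in_ab => //; rewrite gt_eqF.
have qab : [set a; b] (q *: v) by apply: in_ab => //; rewrite gt_eqF//; lra.
have rab : [set a; b] (- r *: v) by apply: in_ab => //; rewrite oppr_eq0 gt_eqF.
by case: pab => pE; case: qab => qE; case: rab => rE;
  (have /scale_inj : p *: v = q *: v by congruence) ||
  (have /scale_inj : p *: v = - r *: v by congruence) ||
  (have /scale_inj : q *: v = - r *: v by congruence); lra.
Qed.

Lemma minkowski_functional_gt0 K v : star_body K -> v != 0 ->
  0 < minkowski_functional K v.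
Proof.
move=> [[Kc Kb] _ K0 _] v0.
have [M M0 KM] := ray_bounded Kb v0.
have [p [p0 _ /(_ p (ltW p0) (lexx _)) Kp]] := ray_first_exit Kc Kb K0 v0.
apply: (@lt_le_trans _ _ M^-1); first by rewrite invr_gt0.
apply: lb_le_inf.
  exists p^-1; split; first by rewrite invr_ge0 ltW.
  by exists (p *: v) => //; rewrite scalerA mulVf ?gt_eqF// scale1r.
move=> a [a0 [y Ky vE]].
have a_gt0 : 0 < a.
  by rewrite lt_def a0 andbT; apply: contra_neq v0 => a_eq0; rewrite vE a_eq0 scale0r.
rewrite invf_ple ?posrE//; apply: KM; first by rewrite invr_ge0.
by rewrite vE scalerA mulVf ?gt_eqF// scale1r.
Qed.

Lemma radius_gt0 K v : star_body K -> v != 0 -> 0 < radius K v.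
Proof. by move=> hK v0; rewrite invr_gt0; exact: minkowski_functional_gt0. Qed.

(** The infimum defining the Minkowski functional gives points of [K] on the ray
    arbitrarily close to [radius K v *: v]; star-shapedness fills the ray below
    them, and closedness adds the end point. *)
Lemma radiusP K v (r : R) : star_body K -> v != 0 -> 0 < r ->
  K (r *: v) <-> r <= radius K v.
Proof.
move=> hK v0 r0; have m0 := minkowski_functional_gt0 hK v0.
have := hK => -[[Kc Kb] _ K0 _].
split=> [Kr|].
  rewrite -[r]invrK lef_pV2 ?posrE ?invr_gt0//.
  apply: ge_inf; first by exists 0 => a [].
  split; first by rewrite invr_ge0 ltW.
  by exists (r *: v) => //; rewrite scalerA mulVf ?gt_eqF// scale1r.
have Klt (s : R) : 0 < s -> s < radius K v -> K (s *: v).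
  move=> s0; rewrite /radius -[s]invrK ltf_pV2 ?posrE ?invr_gt0// => ms.
  have [|a [a0 [y Ky vE]] ais] := inf_lt _ ms.
    have [p [p0 _ /(_ p (ltW p0) (lexx _)) Kp]] := ray_first_exit Kc Kb K0 v0.
    exists p^-1; split; first by rewrite invr_ge0 ltW.
    by exists (p *: v) => //; rewrite scalerA mulVf ?gt_eqF// scale1r.
  have a_gt0 : 0 < a.
    by rewrite lt_def a0 andbT; apply: contra_neq v0 => a_eq0; rewrite vE a_eq0 scale0r.
  rewrite invrK; apply: (@star_body_segment K v s a^-1) => //.
    by rewrite -[s]invrK lef_pV2 ?posrE ?invr_gt0// ltW.
  by rewrite vE scalerA mulVf ?gt_eqF// scale1r.
rewrite le_eqVlt => /predU1P[rE|]; last exact: Klt.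
apply: (@closed_cvg _ _ r^'- _ (fun s : R => s *: v) K Kc _ (r *: v)).
  near=> s; apply: Klt; last by rewrite -rE; near: s; exact: nbhs_left_lt.
  by near: s; exact: nbhs_left_gt.
by apply: cvg_at_left_filter; exact: scalel_continuous.
Unshelve. all: by end_near. Qed.

Lemma esphere_neq0 u : esphere R n u -> u != 0.
Proof. by move=> u1; rewrite -enorm_gt0 u1. Qed.

Lemma radius_continuous K u : star_body K -> u != 0 -> {for u, continuous (radius K)}.
Proof.
move=> hK u0.
have m0 : minkowski_functional K u != 0 by rewrite gt_eqF// minkowski_functional_gt0.
case: (hK) => _ _ _ /(_ u) c.
exact: (cvgV m0 c).
Qed.

End star_bodies.

(** * Radial masses of a density *)

Section radial_mass.
Context (R : realType).
Local Notation leb := (@lebesgue_measure R).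

Lemma continuous_itv_integrable (g : R -> R) (a b : R) : continuous g ->
  leb.-integrable `]a, b] (EFin \o g).
Proof.
move=> cg; apply: (@integrableS _ _ _ leb `[a, b]%classic) => //; last first.
  apply: continuous_compact_integrable; first exact: segment_compact.
  exact: continuous_subspaceT.
by move=> r /=; rewrite !in_itv/= => /andP[/ltW -> ->].
Qed.

(** Rescaling of [radial_mass] to the fixed interval [0, 1], so that continuity
    in the end point becomes continuity in the integrand; see [radial_massE]. *)
Definition cone_mass n j (f : 'rV[R]_n -> R) (x : 'rV[R]_n) : R :=
  \int[leb]_(s in `]0, 1]) (s ^+ j * f (s *: x)).

(** The interval is open at [0] because of the case [j = 0]: there [r ^+ j]
    does not vanish at [0], while the polar formula integrates over [r > 0]. *)
Definition radial_mass n j (f : 'rV[R]_n -> R) (K : set 'rV[R]_n) (u : 'rV[R]_n) : R :=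
  \int[leb]_(r in `]0, radius K u]) (r ^+ j * f (r *: u)).

Section continuous_density.
Variables (n : nat) (f : 'rV[R]_n -> R).
Hypothesis f_cont : continuous f.

Lemma ray_density_continuous j (x : 'rV[R]_n) :
  continuous (fun r : R => r ^+ j * f (r *: x)).
Proof.
move=> r; apply: cvgM; first exact: exprn_continuous.
by apply: continuous_comp; [exact: scalel_continuous|exact: f_cont].
Qed.

Lemma ray_density_integrable j (x : 'rV[R]_n) (a : R) :
  leb.-integrable `]0, a] (EFin \o (fun r : R => r ^+ j * f (r *: x))).
Proof. exact/continuous_itv_integrable/ray_density_continuous. Qed.

(** By compactness of [0, 1], [f (s *: y)] tends to [f (s *: y0)] uniformly
    in [s] as [y] tends to [y0]. *)
Lemma cone_mass_continuous j : continuous (cone_mass j f).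
Proof.
move=> y0; apply/(@cvgrPdist_le _ _ _ _ (nbhs_filter y0)) => /= e e0.
have near01 : \forall y \near y0, `[0%R, 1%R]%classic `<=`
    (fun s : R => `|f (s *: y0) - f (s *: y)| < e).
  have /compact_near_coveringP cov := @segment_compact R 0 1.
  apply: (cov _ (nbhs y0) (fun y s => `|f (s *: y0) - f (s *: y)| < e) _) => s _.
  pose h (p : R * 'rV[R]_n) := f (p.1 *: y0) - f (p.1 *: p.2).
  have hc : {for (s, y0), continuous h}.
    apply: cvgB.
      apply: (@continuous_comp _ _ _ (fun p : R * 'rV[R]_n => p.1 *: y0) f);
        last exact: f_cont.
      apply: (@continuous_comp _ _ _ fst (fun t : R => t *: y0)); first exact: cvg_fst.
      exact: scalel_continuous.
    apply: (@continuous_comp _ _ _ (fun p : R * 'rV[R]_n => p.1 *: p.2) f);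
      last exact: f_cont.
    exact: scale_continuous.
  have := @cvgr_dist_lt _ _ _ _ (nbhs_filter (s, y0)) _ _ hc _ e0.
  by apply: filterS => -[t y] /=; rewrite /h/= subrr sub0r normrN.
near=> y.
have yP : `[0%R, 1%R]%classic `<=` (fun s : R => `|f (s *: y0) - f (s *: y)| < e) by near: y.
rewrite /cone_mass -RintegralB//; [|exact: ray_density_integrable..].
have int_diff : leb.-integrable `]0, 1]
    (EFin \o (fun s : R => s ^+ j * f (s *: y0) - s ^+ j * f (s *: y))).
  have mI : measurable (`]0, 1]%classic : set (measurableTypeR R)) by exact: measurable_itv.
  exact: (integrableB mI (ray_density_integrable j y0 1) (ray_density_integrable j y 1)).
apply: (le_trans (le_normr_Rintegral _ int_diff)) => //.
have -> : e = \int[leb]_(s in `]0, 1]) e.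
  by rewrite Rintegral_cst//= lebesgue_measure_itv/= lte_fin ltr01 oppr0 adde0 mulr1.
apply: le_Rintegral => //.
- exact: integrable_norm.
- by apply: continuous_itv_integrable; exact: cst_continuous.
- move=> s /=; rewrite in_itv/= => /andP[/ltW s0 s1].
  rewrite -mulrBr normrM -[leRHS]mul1r ler_pM//.
    by rewrite ger0_norm ?exprn_ge0 ?exprn_ile1.
  by apply/ltW/yP; rewrite /= in_itv/= s0 s1.
Unshelve. all: by end_near. Qed.

Hypothesis f_ge0 : forall x, 0 <= f x.

Lemma ray_integralE j (x : 'rV[R]_n) (a : R) :
  (\int[leb]_(r in `]0%R, a]) (r ^+ j * f (r *: x))%:E)%E =
  (\int[leb]_(r in `]0, a]) (r ^+ j * f (r *: x)))%:E.
Proof. by rewrite fineK//; apply: integrable_fin_num => //; exact: ray_density_integrable. Qed.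

Lemma radial_massE j (K : set 'rV[R]_n) (u : 'rV[R]_n) : 0 < radius K u ->
  radial_mass j f K u = radius K u ^+ j.+1 * cone_mass j f (radius K u *: u).
Proof.
rewrite /radial_mass /cone_mass; set a := radius K u => a0.
apply: EFin_inj; rewrite EFinM -!ray_integralE.
have mh (x : 'rV[R]_n) : measurable_fun setT (fun r : R => (r ^+ j * f (r *: x))%:E).
  apply/measurable_EFinP; apply: continuous_measurable_fun.
  exact: ray_density_continuous.
rewrite [LHS]integral_mkcond (ge0_integral_scale1 a0); last 2 first.
- by apply/(measurable_restrictT _ _).1 => //; exact: measurable_funTS.
- move=> r; rewrite patchE; case: ifPn => //; rewrite inE/= in_itv/= => /andP[/ltW r0 _].
  by rewrite lee_fin mulr_ge0// exprn_ge0.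
rewrite exprS EFinM -muleA; congr (_ * _)%E.
rewrite -ge0_integralZl//; last 3 first.
- exact: (measurable_funTS (mh (a *: u))).
- move=> s /=; rewrite in_itv/= => /andP[/ltW s0 _].
  by rewrite lee_fin mulr_ge0// exprn_ge0.
- by rewrite lee_fin exprn_ge0// ltW.
rewrite [RHS]integral_mkcond; apply: eq_integral => s _.
rewrite !patchE.
have -> : (a * s \in `]0, a]%classic) = (s \in `]0, 1]%classic).
  by apply/idP/idP; rewrite !inE/= !in_itv/= pmulr_rgt0// ger_pMr.
case: ifPn => // _; rewrite -EFinM mulrA -exprMn scalerA.
by rewrite [s * a]mulrC.
Qed.

Lemma radial_mass_continuous j (K : set 'rV[R]_n) : star_body K ->
  {within esphere R n, continuous (radial_mass j f K)}.
Proof.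
move=> hK.
pose g u := radius K u ^+ j.+1 * cone_mass j f (radius K u *: u).
apply: (@subspace_eq_continuous _ _ _ g) => [u|].
  rewrite inE => /esphere_neq0 u0; apply/esym/radial_massE.
  exact: radius_gt0.
apply: continuous_in_subspaceT => u; rewrite inE => /esphere_neq0 u0.
have rc := radius_continuous hK u0.
apply: (@cvgM _ _ (nbhs u) (nbhs_filter u)).
  exact: (@continuous_comp _ _ _ (radius K) (fun t : R => t ^+ j.+1) u rc
    (@exprn_continuous R j.+1 _)).
apply: (@continuous_comp _ _ _ (fun v => radius K v *: v) (cone_mass j f));
  last exact: cone_mass_continuous.
exact: (@cvgZ _ _ _ (nbhs u) (nbhs_filter u) _ _ _ _ rc cvg_id).
Qed.

End continuous_density.

End radial_mass.

(** * Star bodies and their sections in polar coordinates *)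

Section star_body_polar.
Context (R : realType).

Lemma star_body_measurable n (K : set 'rV[R]_n) : star_body K -> measurable K.
Proof. by case=> -[Kc _] _ _ _; exact: closed_measurable_rV. Qed.

(** The isometry [phi] is the identity for the body itself and the
    parametrization of a subspace for a section; the polar formula is taken in
    the source of [phi], where both measures on a subspace are defined. *)
Lemma ge0_integral_star_body n m (phi : 'rV[R]_m.+1 -> 'rV[R]_n)
    (f : 'rV[R]_n -> R) (K : set 'rV[R]_n) :
  measurable_fun setT phi -> (forall r y, phi (r *: y) = r *: phi y) ->
  (forall y, enorm (phi y) = enorm y) ->
  continuous f -> (forall x, 0 <= f x) -> star_body K ->
  (\int[lebesgue_rV R m.+1]_(y in phi @^-1` K) (f (phi y))%:E =
   \int[surface_measure R m.+1]_(u in esphere R m.+1)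
     (radial_mass m f K (phi u))%:E)%E.
Proof.
move=> mphi phiZ phi_enorm f_cont f_ge0 hK.
have mK := star_body_measurable hK.
have mphiK : measurable (phi @^-1` K) by rewrite -[X in measurable X]setTI; exact: mphi.
have mf := continuous_measurable_rV f_cont.
have mfphi : measurable_fun setT (fun y => (f (phi y))%:E).
  by apply/measurable_EFinP; exact: (measurableT_comp mf mphi).
rewrite integral_mkcond ge0_integral_polar; last 2 first.
- by apply/(measurable_restrictT _ _).1 => //; exact: measurable_funTS.
- by move=> y; rewrite patchE; case: ifPn => // _; rewrite lee_fin.
apply: eq_integral => u; rewrite inE => uS.
have phiu0 : phi u != 0 by rewrite -enorm_gt0 phi_enorm uS.
rewrite /radial_mass -ray_integralE// [RHS]integral_mkcond.
apply: eq_integral => r _; rewrite !patchE indicE.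
have [r0|r0] := ltP 0 r; last first.
  have rN (i : itv_bound R) : r \notin [set` Interval (BRight 0) i].
    by apply/negP; rewrite inE/= itv_boundlr/= => /andP[+ _]; rewrite bnd_simp ltNge r0.
  by rewrite !(negbTE (rN _)) mul0r mul0e.
rewrite (mem_set (_ : `]0%R, +oo[%classic r)) ?mul1r/=; last by rewrite in_itv/= r0.
have -> : (r *: u \in phi @^-1` K) = (r \in `]0, radius K (phi u)]%classic).
  apply/idP/idP; rewrite !inE/= in_itv/= r0/= phiZ.
    by move/(radiusP hK phiu0 r0).
  by move=> ?; apply/(radiusP hK phiu0 r0).
by case: ifPn => _; rewrite ?mule0// phiZ EFinM.
Qed.

Lemma surface_esphere n : surface_measure R n.+1 (esphere R n.+1) =
  (n.+1%:R * vol (eball R n.+1))%:E.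
Proof.
have mS := @measurable_esphere R n.+1.
have mB := @measurable_eball R n.+1.
have m0 := @measurable_singleton0 R n.+1.
have l0 := @lebesgue_singleton0 R n.+1 isT.
rewrite -[LHS]mul1e -integral_cst// ge0_integral_surface//.
rewrite EFinM /vol fineK ?lebesgue_eball_fin_num//; congr (_ * _)%E.
rewrite -(ge0_negligible_integral m0 mB (f := cst 1%:E)) ?integral_cst ?mul1e//.
Qed.

Lemma esphere_compact n : compact (esphere R n).
Proof.
apply: bounded_closed_compact.
  exists 1; split; first exact: num_real.
  move=> M M1 x xS; rewrite /Num.norm/= mx_normrE.
  apply/bigmax_leP; split => [|[i j] _]; first by rewrite (le_trans _ (ltW M1)).
  by rewrite (ord1 i) (le_trans (coord_le_enorm _ _))// xS ltW.
rewrite (_ : esphere R n = @enorm R n @^-1` [set 1]) //.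
by apply: closed_comp; [move=> x _; exact: enorm_continuous|exact: closed_eq].
Qed.

Lemma esphere_bounded n (g : 'rV[R]_n -> R) (D : set 'rV[R]_n) :
  {within esphere R n, continuous g} -> D `<=` esphere R n -> [bounded g x | x in D].
Proof.
move=> cg DS.
have [M [Mr HM]] := compact_bounded (continuous_compact cg (@esphere_compact n)).
exists M; split => // x Mx y Dy; apply: (HM x Mx).
by exists y => //; exact: DS.
Qed.

Lemma surface_integrable n (g : 'rV[R]_n.+1 -> R) :
  {within esphere R n.+1, continuous g} ->
  (surface_measure R n.+1).-integrable (esphere R n.+1) (EFin \o g).
Proof.
move=> cg; apply: measurable_bounded_integrable.
- exact: measurable_esphere.
- by rewrite [X in (X < _)%E]surface_esphere ltry.
- by apply: within_continuous_measurable_rV => //; exact: measurable_esphere.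
- by apply: esphere_bounded cg _.
Qed.

Section sections.
Variables (n m : nat) (H : grassmannian R n m.+1).
Local Notation SH := (esphere R n `&` [set` \val H]).
Local Notation phi := (@embed R n m.+1 (\val H)).

Let HP : orthonormal_frame (\val H) (frame m.+1 (\val H)).
Proof. exact/frameP/eqP/(valP H). Qed.

Lemma embed_in y : phi y \in \val H.
Proof. by apply/HP.2; exists y. Qed.

Lemma enorm_embed y : enorm (phi y) = enorm y.
Proof.
have enormE d (x : 'rV[R]_d) : (x *m x^T) ord0 ord0 = \sum_i x ord0 i ^+ 2.
  by rewrite mxE; apply: eq_bigr => i _; rewrite mxE expr2.
rewrite /enorm -!enormE /embed trmx_mul mulmxA -(mulmxA y) HP.1 mulmx1//.
Qed.

Lemma embedZ (r : R) y : phi (r *: y) = r *: phi y.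
Proof. by rewrite /embed scalemxAl. Qed.

Lemma measurable_subspace : measurable [set` \val H].
Proof.
pose P := frame m.+1 (\val H).
have -> : [set` \val H] = \bigcap_(i in [set: 'I_n])
    (fun x : 'rV[R]_n => (x *m P^T *m P - x) ord0 i) @^-1` [set 0].
  apply/seteqP; split => [x /= /HP.2[y ->] i _ /=|x xP /=].
    by rewrite -(mulmxA y) HP.1 mulmx1 subrr mxE.
  apply/HP.2; exists (x *m P^T); apply/esym/eqP; rewrite -subr_eq0; apply/eqP/rowP => i.
  by rewrite [RHS]mxE; exact: xP.
apply: fin_bigcap_measurable => // i _.
rewrite -[X in measurable X]setTI.
suff mc : measurable_fun setT (fun x : 'rV[R]_n => (x *m P^T *m P - x) ord0 i) by exact: mc.
under eq_fun do rewrite -mulmxA !mxE.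
apply: measurable_funB; last exact: measurable_coord.
apply: measurable_sum => j; apply: measurable_funM => //.
exact: measurable_coord.
Qed.

Lemma embed_preimage_esphere : phi @^-1` SH = esphere R m.+1.
Proof.
apply/seteqP; split => [y [/=]|y yS].
  by rewrite /esphere/= enorm_embed.
by split; [rewrite /= /esphere/= enorm_embed|exact: embed_in].
Qed.

Lemma measurable_SH : measurable SH.
Proof. by apply: measurableI; [exact: measurable_esphere|exact: measurable_subspace]. Qed.

Lemma subspace_surface_integrable (g : 'rV[R]_n -> R) :
  {within esphere R n, continuous g} ->
  (on_subspace (surface_measure R m.+1) (\val H)).-integrable SH (EFin \o g).
Proof.
move=> cg; apply: measurable_bounded_integrable.
- exact: measurable_SH.
- rewrite /= /on_subspace /pushforward embed_preimage_esphere.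
  by rewrite [X in (X < _)%E]surface_esphere ltry.
- apply: (measurable_funS (@measurable_esphere R n)) => //.
  by apply: within_continuous_measurable_rV => //; exact: measurable_esphere.
- by apply: esphere_bounded cg _.
Qed.

Lemma radon_ge0E (g : 'rV[R]_n -> R) : {within esphere R n, continuous g} ->
  (forall u, esphere R n u -> 0 <= g u) ->
  ((radon g H)%:E =
   \int[surface_measure R m.+1]_(u in esphere R m.+1) (g (phi u))%:E)%E.
Proof.
move=> cg g0; rewrite /radon /Rintegral fineK; last first.
  apply: integrable_fin_num; [exact: measurable_SH|exact: subspace_surface_integrable].
rewrite (ge0_integral_pushforward (measurable_embed (\val H))).
- by rewrite embed_preimage_esphere.
- exact: measurable_SH.
- apply/measurable_EFinP; apply: (measurable_funS (@measurable_esphere R n)) => //.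
  by apply: within_continuous_measurable_rV => //; exact: measurable_esphere.
- by move=> u; rewrite inE => -[uS _]; rewrite lee_fin; exact: g0.
Qed.

Lemma density_section_radon (f : 'rV[R]_n -> R) (K : set 'rV[R]_n) :
  continuous f -> (forall x, 0 <= f x) -> star_body K ->
  density_section f K H = (radon (radial_mass m f K) H)%:E.
Proof.
move=> cf f0 hK; rewrite radon_ge0E; last 2 first.
- exact: radial_mass_continuous.
- move=> u _; apply: Rintegral_ge0 => r /=; rewrite in_itv/= => /andP[/ltW r0 _].
  by rewrite mulr_ge0// exprn_ge0.
have mphi := @measurable_embed R n m.+1 (\val H).
rewrite -(ge0_integral_star_body mphi embedZ enorm_embed)//.
rewrite /density_section (ge0_integral_pushforward mphi).
- rewrite preimage_setI (_ : phi @^-1` [set` \val H] = setT) ?setIT//.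
  by apply/seteqP; split => // y _; exact: embed_in.
- by apply: measurableI; [exact: star_body_measurable|exact: measurable_subspace].
- by apply/measurable_EFinP/measurable_funTS; exact: continuous_measurable_rV.
- by move=> u _; rewrite lee_fin.
Qed.

End sections.

Lemma density_measure_radial n (f : 'rV[R]_n.+1 -> R) (K : set 'rV[R]_n.+1) :
  continuous f -> (forall x, 0 <= f x) -> star_body K ->
  density_measure f K =
  (\int[surface_measure R n.+1]_(u in esphere R n.+1) radial_mass n f K u)%:E.
Proof.
move=> cf f0 hK; rewrite fineK; last first.
  apply: integrable_fin_num; first exact: measurable_esphere.
  by apply: surface_integrable; exact: radial_mass_continuous.
exact: (@ge0_integral_star_body _ _ id).
Qed.

End star_body_polar.

(** * One-dimensional inequalities *)

Section inequalities.
Context (R : realType).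
Local Notation leb := (@lebesgue_measure R).

(** The difference of the two sides is the integral over [0, b] minus that
    over [0, a] of [(r ^ k - a ^ k) r ^ j phi r], a function that is nonpositive
    before [a] and nonnegative after it. *)
Lemma moment_comparison (phi : R -> R) j k (a b : R) :
  continuous phi -> (forall r, 0 <= phi r) -> 0 <= a -> 0 <= b ->
  \int[leb]_(r in `]0, a]) (r ^+ (j + k) * phi r) +
    a ^+ k * \int[leb]_(r in `]0, b]) (r ^+ j * phi r) <=
  \int[leb]_(r in `]0, b]) (r ^+ (j + k) * phi r) +
    a ^+ k * \int[leb]_(r in `]0, a]) (r ^+ j * phi r).
Proof.
move=> cphi phi0 a0 b0.
pose h (r : R) := r ^+ (j + k) * phi r - a ^+ k * (r ^+ j * phi r).
have cX i : continuous (fun r : R => r ^+ i * phi r).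
  by move=> r; apply: cvgM; [exact: exprn_continuous|exact: cphi].
have ch : continuous h.
  move=> r; apply: cvgB; first exact: cX.
  by apply: cvgM; [exact: cvg_cst|exact: cX].
have hE x : \int[leb]_(r in `]0, x]) h r = \int[leb]_(r in `]0, x]) (r ^+ (j + k) * phi r) -
    a ^+ k * \int[leb]_(r in `]0, x]) (r ^+ j * phi r).
  rewrite RintegralB//; last 2 first.
  - exact: continuous_itv_integrable.
  - by apply: continuous_itv_integrable => r; apply: cvgM; [exact: cvg_cst|exact: cX].
  by rewrite RintegralZl//; exact: continuous_itv_integrable.
suff : \int[leb]_(r in `]0, a]) h r <= \int[leb]_(r in `]0, b]) h r.
  by rewrite !hE lerBlDr addrAC lerBrDr.
have hfactor (r : R) : h r = (r ^+ k - a ^+ k) * (r ^+ j * phi r).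
  by rewrite /h exprD; ring.
have [ab|/ltW ba] := leP a b.
- rewrite -subr_ge0 (Rintegral_itvB (b := BRight b)) ?bnd_simp//;
    last exact: continuous_itv_integrable.
  apply: Rintegral_ge0 => r /=; rewrite in_itv/= => /andP[/ltW ar rb].
  have r0 : 0 <= r by exact: le_trans ar.
  rewrite hfactor mulr_ge0 ?mulr_ge0 ?exprn_ge0// subr_ge0.
  by apply: lerXn2r => //; rewrite nnegrE.
- rewrite -subr_le0 (Rintegral_itvB (b := BRight a)) ?bnd_simp//;
    last exact: continuous_itv_integrable.
  rewrite -[leRHS](mul0r (fine (leb `]b, a]%classic))) -Rintegral_cst//.
  apply: le_Rintegral => //; [exact: continuous_itv_integrable| |].
    by apply: continuous_itv_integrable; exact: cst_continuous.
  move=> r /=; rewrite in_itv/= => /andP[/ltW br ra].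
  have r0 : 0 <= r by exact: le_trans br.
  rewrite hfactor mulr_le0_ge0 ?mulr_ge0 ?exprn_ge0// subr_le0.
  by apply: lerXn2r => //; rewrite nnegrE.
Qed.

(** Young's inequality for [(x / t) ^ k] and [1], with exponents [(m + k) / k] and
    [(m + k) / m]. The scale [t] is free, to be chosen so that integrating gives
    Hoelder's inequality. *)
Lemma young_pow (x t : R) (k m : nat) : 0 <= x -> 0 < t -> (0 < k)%N -> (0 < m)%N ->
  x ^+ k <= t ^+ k * (k%:R / (m + k)%:R * (x ^+ (m + k) / t ^+ (m + k)) + m%:R / (m + k)%:R).
Proof.
move=> x0 t0 k0 m0.
have n0 : (0 : R) < (m + k)%:R by rewrite ltr0n addn_gt0 m0.
have kR : (0 : R) < k%:R by rewrite ltr0n.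
have mR : (0 : R) < m%:R by rewrite ltr0n.
pose y := x / t.
have y0 : 0 <= y by rewrite divr_ge0// ltW.
pose n : R := (m + k)%:R.
have p0 : 0 < n / k%:R by rewrite divr_gt0.
have q0 : 0 < n / m%:R by rewrite divr_gt0.
have pq : (n / k%:R)^-1 + (n / m%:R)^-1 = 1.
  by rewrite !invf_div -mulrDl [k%:R + _]addrC -natrD mulfV// gt_eqF.
have powE : (y ^+ k) `^ (n / k%:R) = y ^+ (m + k).
  by rewrite -(powR_mulrn k y0) -powRrM mulrCA mulfV ?gt_eqF// mulr1 powR_mulrn.
have := conjugate_powR (exprn_ge0 k y0) ler01 p0 q0 pq.
rewrite powR1 mulr1 mul1r powE !invf_div /y !expr_div_n ler_pdivrMr ?exprn_gt0//.
by rewrite mulrC [_ / t ^+ _ * _]mulrC.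
Qed.

Lemma Rintegral_pow01 j : \int[leb]_(s in `]0, 1]) (s ^+ j) = j.+1%:R^-1.
Proof.
have cX i : continuous (fun s : R => s ^+ i) by exact: exprn_continuous.
pose F (s : R) : R := j.+1%:R^-1 * s ^+ j.+1.
have cF : continuous F by move=> s; apply: cvgM; [exact: cvg_cst|exact: cX].
have dF (x : R) : is_derive x 1 F (x ^+ j).
  have := @is_deriveX R R^o (id : R^o -> R) j.+1 x 1 1 (is_derive_id _ _).
  rewrite exprfctE /GRing.scale/= mulr1 => dX.
  have := @is_deriveZ R R^o R^o _ j.+1%:R^-1 x 1 _ dX.
  by rewrite /GRing.scale/= mulrA mulVf// mul1r.
rewrite Rintegral_itv_obnd_cbnd; last exact: continuous_itv_integrable.
rewrite /Rintegral (@continuous_FTC2 _ _ F)//=.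
- by rewrite /F expr1n expr0n/= mulr0 subr0 mulr1.
- exact: continuous_subspaceT.
- split => //; first exact: cvg_at_right_filter (cF 0).
  exact: cvg_at_left_filter (cF 1).
- by move=> x _; rewrite derive1E derive_val.
Qed.

End inequalities.

(** * Volume and powers of the radius *)

Section volume.
Context (R : realType).

Lemma radius_pow_continuous n (K : set 'rV[R]_n) i : star_body K ->
  {within esphere R n, continuous (fun u => radius K u ^+ i)}.
Proof.
move=> hK; apply: continuous_in_subspaceT => u; rewrite inE => /esphere_neq0 u0.
have rc := radius_continuous hK u0.
exact: (@continuous_comp _ _ _ (radius K) (fun t : R => t ^+ i) u rc
  (@exprn_continuous R i _)).
Qed.

Lemma lebesgue_radius n (K : set 'rV[R]_n.+1) : star_body K ->
  lebesgue_rV R n.+1 K = (n.+1%:R^-1 *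
    \int[surface_measure R n.+1]_(u in esphere R n.+1) (radius K u ^+ n.+1))%:E.
Proof.
move=> hK; have c1 : continuous (fun _ : 'rV[R]_n.+1 => 1 : R) by exact: cst_continuous.
rewrite -[LHS]mul1e -integral_cst; last exact: star_body_measurable.
rewrite [LHS](density_measure_radial c1)//.
rewrite -RintegralZl; last 2 first.
- exact: measurable_esphere.
- by apply: surface_integrable; exact: radius_pow_continuous.
congr _%:E; apply: eq_Rintegral => u; rewrite inE => /esphere_neq0 u0.
rewrite radial_massE//; last exact: radius_gt0.
rewrite mulrC; congr (_ * _); rewrite -Rintegral_pow01.
by apply: eq_Rintegral => s _; rewrite mulr1.
Qed.

Lemma vol_star_body_gt0 n (K : set 'rV[R]_n.+1) : star_body K -> 0 < vol K.
Proof.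
move=> hK; have Koo : (lebesgue_rV R n.+1 K < +oo)%E by rewrite lebesgue_radius// ltry.
rewrite /vol fine_gt0// Koo andbT.
have [_ _ /nbhs_ballP[e /= e0 eK] _] := hK.
apply: (@lt_le_trans _ _ (lebesgue_rV R n.+1 (cube n.+1 (e / 2)))).
  by rewrite lebesgue_cube ?divr_ge0 ?ltW// lte_fin exprn_gt0// mulr_gt0// divr_gt0.
apply: le_measure; rewrite ?inE.
- exact: measurable_cube.
- exact: star_body_measurable.
move=> x xe; apply: eK; split => // i j; rewrite (ord1 i) /ball/= mxE sub0r normrN.
by rewrite (le_lt_trans (xe j))// ltr_pdivrMr// ltr_pMr// ltr1n.
Qed.

(** Hoelder's inequality for [radius K ^ k] on the sphere, where the integral of
    [radius K ^ n] is [n] times the volume of [K] and the total mass is [n]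
    times that of the unit ball. *)
Lemma integral_radius_pow_le j k (K : set 'rV[R]_(j + k).+1) : (0 < k)%N -> star_body K ->
  \int[surface_measure R (j + k).+1]_(u in esphere R (j + k).+1) (radius K u ^+ k) <=
  (j + k).+1%:R * vol (eball R (j + k).+1) `^ (j.+1%:R / (j + k).+1%:R) *
  vol K `^ (k%:R / (j + k).+1%:R).
Proof.
move=> k0 hK; set n := (j + k).+1.
pose sigma := surface_measure R n; pose S := esphere R n.
have mS : measurable S := @measurable_esphere R n.
have n0 : (0 : R) < n%:R by [].
set beta := vol (eball R n); set V := vol K.
have beta0 : 0 < beta by exact: vol_eball_gt0.
have V0 : 0 < V by exact: vol_star_body_gt0.
(* the radius of the ball with the volume of [K]: Young's inequality is then an
   equality when [K] is a ball *)
pose t := (V / beta) `^ n%:R^-1.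
have t0 : 0 < t by rewrite powR_gt0// divr_gt0.
have tn : t ^+ n = V / beta.
  by rewrite -powR_mulrn ?powR_ge0// -powRrM mulVf ?gt_eqF// powRr1// ltW// divr_gt0.
have tk : t ^+ k = (V / beta) `^ (k%:R / n%:R).
  by rewrite -powR_mulrn ?powR_ge0// -powRrM [n%:R^-1 * _]mulrC.
have intX i : sigma.-integrable S (EFin \o (fun u => radius K u ^+ i)).
  by apply: surface_integrable; exact: radius_pow_continuous.
have int1 (c : R) : sigma.-integrable S (EFin \o (fun=> c)).
  by apply: surface_integrable; apply: continuous_subspaceT; exact: cst_continuous.
have VE : \int[sigma]_(u in S) (radius K u ^+ n) = n%:R * V.
  by rewrite /V /vol lebesgue_radius//= mulrA mulfV ?gt_eqF// mul1r.
pose c1 := t ^+ k * (k%:R / n%:R / t ^+ n); pose c2 := t ^+ k * (j.+1%:R / n%:R).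
have int2 : sigma.-integrable S (EFin \o (fun u => c1 * radius K u ^+ n)).
  exact: (integrableZl mS c1 (intX n)).
apply: (@le_trans _ _ (\int[sigma]_(u in S) (c1 * radius K u ^+ n + c2))).
  apply: le_Rintegral => //.
    exact: (integrableD mS int2 (int1 c2)).
  move=> u uS.
  have rho0 := ltW (radius_gt0 hK (esphere_neq0 uS)).
  have /le_trans := @young_pow R (radius K u) t k j.+1 rho0 t0 k0 isT.
  by apply; rewrite le_eqVlt; apply/orP; left; apply/eqP; rewrite /c1 /c2 addSn -/n; ring.
rewrite RintegralD// RintegralZl// VE Rintegral_cst// [X in c2 * fine X]surface_esphere/=.
rewrite -/n -/beta.
have -> : c1 * (n%:R * V) + c2 * (n%:R * beta) = n%:R * (t ^+ k * beta).
  have kE : k%:R = n%:R - j.+1%:R :> R by rewrite /n -addSn natrD addrAC subrr add0r.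
  rewrite /c1 /c2 tn kE; field.
  by rewrite !gt_eqF.
rewrite -mulrA ler_pM2l// tk.
have -> : V `^ (k%:R / n%:R) = (V / beta) `^ (k%:R / n%:R) * beta `^ (k%:R / n%:R).
  have Vb0 : 0 <= V / beta by rewrite ltW// divr_gt0.
  by rewrite -(powRM _ Vb0 (ltW beta0)) divfK// gt_eqF.
rewrite mulrCA -powRD; last by rewrite (gt_eqF beta0) implybT.
by rewrite -mulrDl -natrD addSn -/n mulfV ?gt_eqF// powRr1// ltW.
Qed.

End volume.

(** * The slicing inequality *)

Section slicing.
Context (R : realType).

(** The constant is the one whose Radon transform is [eps] everywhere: the unit
    sphere of a [j.+1]-dimensional subspace has area [j.+1 * vol eball]. *)
Lemma radon_shift_ge0 n j (gK gL : 'rV[R]_n -> R) (eps : R) (H : grassmannian R n j.+1) :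
  {within esphere R n, continuous gK} -> {within esphere R n, continuous gL} ->
  radon gK H <= radon gL H + eps ->
  0 <= radon (fun u => gL u + eps / (j.+1%:R * vol (eball R j.+1)) - gK u) H.
Proof.
move=> cK cL KL.
set c := eps / _.
have mS := measurable_SH H.
have cc : {within esphere R n, continuous (fun=> c : R)}.
  by apply: continuous_subspaceT; exact: cst_continuous.
have iK := subspace_surface_integrable H cK.
have iL := subspace_surface_integrable H cL.
have ic := subspace_surface_integrable H cc.
rewrite /radon RintegralB//; last exact: (integrableD mS iL ic).
rewrite RintegralD// subr_ge0.
have -> : \int[on_subspace (surface_measure R j.+1) (\val H)]_(x in
    esphere R n `&` [set` \val H]) c = eps; last exact: KL.
rewrite Rintegral_cst// /= /on_subspace /pushforward embed_preimage_esphere.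
rewrite [X in c * fine X]surface_esphere /c divfK// mulf_neq0//.
by rewrite gt_eqF// vol_eball_gt0.
Qed.

(** The theorem in dimension [(j + k).+1] with sections of dimension [j.+1]: with
    these parameters all dimensions are successors by computation. *)
Lemma slicing_inequality j k (f : 'rV[R]_(j + k).+1 -> R) (K L : set 'rV[R]_(j + k).+1)
    (eps : R) nu :
  (0 < k)%N -> continuous f -> (forall x, 0 <= f x) -> star_body K -> star_body L ->
  0 < eps -> positive_functional (m := j.+1) nu ->
  (forall g : 'rV[R]_(j + k).+1 -> R, {within esphere R (j + k).+1, continuous g} ->
    \int[surface_measure R (j + k).+1]_(x in esphere R (j + k).+1)
      (minkowski_functional K x ^- k * g x) = nu (radon g)) ->
  (forall H : grassmannian R (j + k).+1 j.+1,
    (density_section f K H <= density_section f L H + eps%:E)%E) ->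
  (density_measure f K <= density_measure f L +
    ((j + k).+1%:R / j.+1%:R *
     (vol (eball R (j + k).+1) `^ (j.+1%:R / (j + k).+1%:R) / vol (eball R j.+1)) *
     vol K `^ (k%:R / (j + k).+1%:R) * eps)%:E)%E.
Proof.
move=> k0 cf f0 hK hL eps0 [_ _ nu_ge0] nuE hsec.
set n := (j + k).+1 in cf f0 hK hL nuE hsec *.
pose sigma := surface_measure R n; pose S := esphere R n.
have mS : measurable S := @measurable_esphere R n.
pose gK := radial_mass j f K; pose gL := radial_mass j f L.
have cK : {within S, continuous gK} by exact: radial_mass_continuous.
have cL : {within S, continuous gL} by exact: radial_mass_continuous.
pose c := eps / (j.+1%:R * vol (eball R j.+1)).
(* the test function: its Radon transform is nonnegative by the hypothesis on
   the sections *)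
pose g u := gL u + c - gK u.
have cg : {within S, continuous g}.
  move=> u; apply: cvgB; last exact: cK.
  by apply: cvgD; [exact: cL|exact: cvg_cst].
have main_ge0 : 0 <= \int[sigma]_(u in S) (radius K u ^+ k * g u).
  have -> : \int[sigma]_(u in S) (radius K u ^+ k * g u) = nu (radon g).
    rewrite -nuE//; apply: eq_Rintegral => u _.
    by rewrite /radius exprVn.
  apply: nu_ge0; first by exists g.
  move=> H; apply: radon_shift_ge0 => //.
  have := hsec H; rewrite !density_section_radon// -EFinD lee_fin.
rewrite !density_measure_radial// -EFinD lee_fin.
have iK := surface_integrable (radial_mass_continuous (j := (j + k)%N) cf f0 hK).
have iL := surface_integrable (radial_mass_continuous (j := (j + k)%N) cf f0 hL).
have crk := @radius_pow_continuous R n K k hK.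
have irk := surface_integrable crk.
have irg : sigma.-integrable S (EFin \o (fun u => radius K u ^+ k * (gL u - gK u))).
  apply: surface_integrable => u; apply: cvgM; first exact: crk.
  by apply: cvgB; [exact: cL|exact: cK].
have irc : sigma.-integrable S (EFin \o (fun u => c * radius K u ^+ k)).
  exact: (integrableZl mS c irk).
have split_g : \int[sigma]_(u in S) (radius K u ^+ k * g u) =
    \int[sigma]_(u in S) (radius K u ^+ k * (gL u - gK u)) +
    c * \int[sigma]_(u in S) (radius K u ^+ k).
  rewrite -RintegralZl// -RintegralD//; apply: eq_Rintegral => u _.
  by rewrite /g; ring.
have pointwise : \int[sigma]_(u in S) radial_mass (j + k) f K u +
    \int[sigma]_(u in S) (radius K u ^+ k * (gL u - gK u)) <=
    \int[sigma]_(u in S) radial_mass (j + k) f L u.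
  rewrite -RintegralD//; apply: le_Rintegral => //.
    exact: (integrableD mS iK irg).
  move=> u /esphere_neq0 u0.
  have cphi : continuous (fun r : R => f (r *: u)).
    by move=> r; apply: continuous_comp; [exact: scalel_continuous|exact: cf].
  have := @moment_comparison R (fun r => f (r *: u)) j k (radius K u) (radius L u) cphi
    (fun r => f0 _) (ltW (radius_gt0 hK u0)) (ltW (radius_gt0 hL u0)).
  rewrite -/(radial_mass (j + k) f K u) -/(radial_mass (j + k) f L u).
  rewrite -/(radial_mass j f K u) -/(radial_mass j f L u) -/(gK u) -/(gL u).
  by rewrite mulrBr addrA lerBlDr.
have c0 : 0 <= c by rewrite divr_ge0 ?ltW// mulr_gt0// vol_eball_gt0.
have holder := ler_wpM2l c0 (integral_radius_pow_le k0 hK).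
have -> : n%:R / j.+1%:R *
     (vol (eball R n) `^ (j.+1%:R / n%:R) / vol (eball R j.+1)) *
     vol K `^ (k%:R / n%:R) * eps =
  c * (n%:R * vol (eball R n) `^ (j.+1%:R / n%:R) * vol K `^ (k%:R / n%:R)).
  have assoc (N M b x y : R) : M != 0 -> b != 0 ->
      N / M * (x / b) * y * eps = eps / (M * b) * (N * x * y).
    by move=> ? ?; field; apply/andP.
  by apply: assoc; rewrite gt_eqF ?vol_eball_gt0.
rewrite split_g in main_ge0.
set A := \int[_]_(u in _) radial_mass (j + k) f K u in pointwise *.
set B := \int[_]_(u in _) radial_mass (j + k) f L u in pointwise *.
set C := \int[_]_(u in _) (radius K u ^+ k * (gL u - gK u)) in pointwise main_ge0.
apply: (@le_trans _ _ (B + c * \int[sigma]_(u in S) radius K u ^+ k)); last by rewrite lerD2l.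
rewrite -lerBlDr; apply: le_trans pointwise; rewrite lerBlDr -addrA lerDl.
exact: main_ge0.
Qed.

End slicing.

Theorem theorem2 (R : realType) (n k : nat) (hk : (1 < k < n)%N)
  (f : 'rV[R]_n -> R) (f_cont : continuous f)
  (f_even : forall x : 'rV[R]_n, f (- x) = f x)
  (f_ge0 : forall x : 'rV[R]_n, 0 <= f x)
  (K L : set 'rV[R]_n)
  (hK : star_body K) (hKs : origin_symmetric K)
  (hL : star_body L) (hLs : origin_symmetric L)
  (hKk : generalized_intersection_body k K)
  (eps : R) (eps_gt0 : 0 < eps)
  (hsec : forall H : grassmannian R n (n - k),
    (density_section f K H <= density_section f L H + eps%:E)%E) :
  (density_measure f K <= density_measure f L +
     (n%:R / (n - k)%:R * radon_constant R n k *
      vol K `^ (k%:R / n%:R) * eps)%:E)%E.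
Proof.
have [k1 kn] := andP hk.
have k0 : (0 < k)%N by exact: ltnW.
case: hKk => _ _ [nu nuP nuE].
rewrite /radon_constant.
have m0 : (0 < n - k)%N by rewrite subn_gt0.
have nE : n = (n - k + k)%N by rewrite subnK// ltnW.
move: (n - k)%N m0 nE nu nuP nuE hsec => [//|j] _ nE.
move: nE f f_cont f_even f_ge0 K L hK hKs hL hLs => {hk kn} ->.
move=> f f_cont _ f_ge0 K L hK _ hL _ nu nuP nuE hsec.
exact: (slicing_inequality k0 f_cont f_ge0 hK hL eps_gt0 nuP nuE hsec).
Qed.
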